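(* Let $X$ and $U$ be Hilbert spaces ($U$ identified with its dual), let $A:D(A)\subset X\to X$ be skew-adjoint, so that $A$ generates a $C_0$-group of isometries on $X$, and let $B\in\mathcal{L}(U,X)$. Suppose that the control system with observation $$\dot z(t)=Az(t)+Bu(t),\qquad y(t)=B^*z(t),\qquad z(0)=z_0$$ (equivalently, the triple of operators $(A,B,B^* )$) is well-posed, and let $H$ be its transfer function. Let $\lambda\in\rho(A)$ be such that $H(\lambda)$ is invertible in $\mathcal{L}(U)$. Then the Grushin problem $$\begin{cases}(\lambda I-A)u+Bu_-=v,\\ B^*u=v_+\end{cases}$$ is well-posed: for every $(v,v_+)\in X\times U$ it has a unique solution $(u,u_-)\in D(A)\times U$, depending boundedly on $(v,v_+)$. Moreover, its effective Hamiltonian $E_{-+}(\lambda)$ is invertible and satisfies $$E_{-+}(\lambda)^{-1}=-B^*(\lambda I-A)^{-1}B=-H(\lambda).$$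
   Context: Here $\rho(A)$ is the resolvent set of $A$. Well-posed triple: the triple $(A,B,B^* )$ is well-posed if $B$ is an admissible control operator and $B^*$ is an admissible observation operator for the semigroup generated by $A$ (both automatic here since $B$ is bounded), and the transfer function is bounded on some half-plane $\{s\in\mathbb{C}:\mathrm{Re}\,s>\alpha\}$. Transfer function: $H:\rho(A)\to\mathcal{L}(U)$ is the function satisfying $$\frac{H(s)-H(\beta)}{s-\beta}=-B^*(sI-A)^{-1}(\beta I-A)^{-1}B\qquad (s,\beta\in\rho(A),\ s\neq\beta)$$ and such that, when $z_0=0$, $\hat y(\lambda)=H(\lambda)\hat u(\lambda)$ for $\mathrm{Re}\,\lambda$ sufficiently large, where $\hat{\ }$ denotes the Laplace transform and $u$ is the input, $y$ the output of the system. Grushin problem: for a linear operator $P:H_1\to H_2$ between Hilbert spaces and operators $R_-:H_-\to H_2$, $R_+:H_1\to H_+$, it is the system $Pu+R_-u_-=v$, $R_+u=v_+$, with unknown $(u,u_-)\in H_1\times H_-$ and given $(v,v_+)\in H_2\times H_+$. It is well-posed if the block operator $\begin{bmatrix} P & R_- \\ R_+ & 0 \end{bmatrix}:H_1\oplus H_-\to H_2\oplus H_+$ has a (bounded) inverse, written $\begin{bmatrix} E & E_+ \\ E_- & E_{-+} \end{bmatrix}:H_2\oplus H_+\to H_1\oplus H_-$; then $E_{-+}$ is called the effective Hamiltonian of $P$. In the claim, $P=\lambda I-A$, $R_-=B$, $R_+=B^*$, $H_1=D(A)$ (with the graph norm), $H_2=X$, $H_-=H_+=U$. *)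

(* Defs.v *)
From HB Require Import structures.
From mathcomp Require Import all_boot all_order all_algebra.
From mathcomp Require Import sesquilinear.
From mathcomp Require Import complex.
From mathcomp Require Import all_classical all_reals all_analysis.

Set Implicit Arguments.
Unset Strict Implicit.
Unset Printing Implicit Defensive.

Import Order.TTheory GRing.Theory Num.Theory.
Import numFieldNormedType.Exports.

Local Open Scope classical_set_scope.
Local Open Scope ring_scope.

(* Complex Hilbert spaces. The inner product is linear in its first argument
   and conjugate-linear in the second; norms take their (real) values
   in R[i]. *)
HB.mixin Record isHilbert (R : realType) (T : Type)
    of CompleteNormedModule R[i] T := {
  hilbert_dot : {dot T for (@conjc R)} ;
  hilbert_norm : forall x : T, `|x| ^+ 2 = hilbert_dot x x
}.

#[short(type="hilbertType")]
HB.structure Definition Hilbert (R : realType) :=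
  {T of CompleteNormedModule R[i] T & isHilbert R T}.

Definition inner (R : realType) (X : hilbertType R) (x y : X) : R[i] :=
  @hilbert_dot R X x y.

Definition bounded_operator (R : realType) (V W : normedModType R[i])
  (f : V -> W) : Prop := linear f /\ continuous f.

Definition adjoint_of (R : realType) (V W : hilbertType R)
    (f : V -> W) (g : W -> V) : Prop :=
  forall v w, inner (f v) w = inner v (g w).

Definition bounded_inverse (R : realType) (V W : normedModType R[i])
    (f : V -> W) (g : W -> V) : Prop :=
  [/\ bounded_operator f, bounded_operator g, cancel f g & cancel g f].

(* The values of [op] outside [dom] are irrelevant. *)
Record unbounded_operator (R : realType) (X : hilbertType R) := UnboundedOp {
  dom : set X ;
  op :> X -> X ;
  dom0 : dom 0 ;
  domP : forall (a : R[i]) x y, dom x -> dom y -> dom (a *: x + y) ;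
  opP : forall (a : R[i]) x y, dom x -> dom y ->
    op (a *: x + y) = a *: op x + op y
}.

(* [adjoint_graph A y w] means that y is in the domain of the adjoint of A,
   with value w. *)
Definition adjoint_graph (R : realType) (X : hilbertType R)
    (A : unbounded_operator X) (y w : X) : Prop :=
  forall x, dom A x -> inner (A x) y = inner x w.

(* D(A) is dense and the adjoint of A is -A, with equality of the domains. *)
Definition skew_adjoint (R : realType) (X : hilbertType R)
    (A : unbounded_operator X) : Prop :=
  dense (dom A) /\
  forall y w, adjoint_graph A y w <-> (dom A y /\ w = - A y).

Definition graph_norm (R : realType) (X : hilbertType R)
    (A : unbounded_operator X) (x : X) : R[i] :=
  sqrtC (`|x| ^+ 2 + `|A x| ^+ 2).

Definition resolvent_of (R : realType) (X : hilbertType R)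
    (A : unbounded_operator X) (s : R[i]) (F : X -> X) : Prop :=
  [/\ bounded_operator F,
      forall x, dom A (F x) /\ s *: F x - A (F x) = x
    & forall x, dom A x -> F (s *: x - A x) = x].

Definition resolvent_set (R : realType) (X : hilbertType R)
    (A : unbounded_operator X) : set R[i] :=
  [set s | exists F, resolvent_of A s F].

(* (sI - A)^-1 when s is in the resolvent set, and 0 otherwise. *)
Definition resolvent (R : realType) (X : hilbertType R)
    (A : unbounded_operator X) (s : R[i]) : X -> X :=
  xget (fun=> 0) [set F | resolvent_of A s F].

Definition simple_function (R : realType) (V : Type) (f : R -> V) : Prop :=
  finite_set (range f) /\ forall v, measurable (f @^-1` [set v]).

Definition strongly_measurable (R : realType) (V : normedModType R[i])
    (D : set R) (f : R -> V) : Prop :=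
  exists2 g : nat -> R -> V, (forall n, simple_function (g n)) &
    {ae (@lebesgue_measure R),
      forall t, D t -> (fun n => g n t) @ \oo --> f t}.

Definition norm_integrable (R : realType) (V : normedModType R[i])
    (D : set R) (f : R -> V) : Prop :=
  strongly_measurable D f /\
  (\int[@lebesgue_measure R]_(t in D) (complex.Re `|f t|)%:E < +oo)%E.

(* L^2(D; V) *)
Definition square_integrable (R : realType) (V : normedModType R[i])
    (D : set R) (f : R -> V) : Prop :=
  strongly_measurable D f /\
  (\int[@lebesgue_measure R]_(t in D) (complex.Re `|f t| ^+ 2)%:E < +oo)%E.

Definition complex_integral (R : realType) (D : set R) (f : R -> R[i]) : R[i] :=
  Complex (Rintegral (@lebesgue_measure R) D (fun t => complex.Re (f t)))
          (Rintegral (@lebesgue_measure R) D (fun t => complex.Im (f t))).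

(* [f] is Bochner integrable on [D] with integral [v]; in a Hilbert space the
   value of the integral is determined by its inner products. *)
Definition bochner_integral (R : realType) (V : hilbertType R)
    (D : set R) (f : R -> V) (v : V) : Prop :=
  norm_integrable D f /\
  forall w, inner v w = complex_integral D (fun t => inner (f t) w).

Definition expc (R : realType) (s : R[i]) : R[i] :=
  Complex (expR (complex.Re s) * cos (complex.Im s))
          (expR (complex.Re s) * sin (complex.Im s)).

Definition laplace (R : realType) (V : hilbertType R)
    (f : R -> V) (s : R[i]) (v : V) : Prop :=
  bochner_integral `[0, +oo[ (fun t => expc (- (s * t%:C%C)) *: f t) v.

Definition C0_semigroup (R : realType) (X : hilbertType R)
    (T : R -> X -> X) : Prop :=
  [/\ forall t, 0 <= t -> bounded_operator (T t),
      forall x, T 0 x = x,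
      forall s t x, 0 <= s -> 0 <= t -> T (s + t) x = T s (T t x)
    & forall x, T h x @[h --> 0^'+] --> x].

Definition generates (R : realType) (X : hilbertType R)
    (A : unbounded_operator X) (T : R -> X -> X) : Prop :=
  C0_semigroup T /\
  forall x y, (dom A x /\ A x = y) <->
    (h^-1)%:C%C *: (T h x - x) @[h --> 0^'+] --> y.

(* Mild solutions on [0, +oo[ of z' = A z + B u, z(0) = z0:
   z(t) = z0 + A (\int_0^t z(r) dr) + \int_0^t B u(r) dr. *)
Definition solution (R : realType) (X U : hilbertType R)
    (A : unbounded_operator X) (B : U -> X) (z0 : X)
    (u : R -> U) (z : R -> X) : Prop :=
  {within `[0, +oo[, continuous z} /\
  forall t, 0 <= t -> exists w b,
    [/\ bochner_integral `[0, t] z w, dom A w,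
        bochner_integral `[0, t] (fun r => B (u r)) b
      & z t = z0 + A w + b].

(* H is the transfer function of (A, B, C). It is a function on the resolvent
   set of A: the values of H elsewhere are irrelevant. *)
Definition transfer_function (R : realType) (X U : hilbertType R)
    (A : unbounded_operator X) (B : U -> X) (C : X -> U)
    (H : R[i] -> U -> U) : Prop :=
  [/\ forall s, resolvent_set A s -> bounded_operator (H s),
      forall s b, resolvent_set A s -> resolvent_set A b -> s != b ->
        forall v, (s - b)^-1 *: (H s v - H b v) =
                  - C (resolvent A s (resolvent A b (B v)))
    & forall u z, square_integrable `[0, +oo[ u -> solution A B 0 u z ->
        exists a : R, forall s, resolvent_set A s -> a < complex.Re s ->
          exists2 v, laplace u s v & laplace (fun t => C (z t)) s (H s v)].

(* The input map u |-> \int_0^tau T(tau - r) B u(r) dr takes its values in X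
   for some tau > 0. *)
Definition admissible_control (R : realType) (X U : hilbertType R)
    (T : R -> X -> X) (B : U -> X) : Prop :=
  exists2 tau : R, 0 < tau & forall u, square_integrable `[0, tau] u ->
    exists x, bochner_integral `[0, tau] (fun r => T (tau - r) (B (u r))) x.

Definition admissible_observation (R : realType) (X U : hilbertType R)
    (A : unbounded_operator X) (T : R -> X -> X) (C : X -> U) : Prop :=
  exists tau k : R, 0 < tau /\ forall x, dom A x ->
    (\int[@lebesgue_measure R]_(t in `[0%R, tau])
       (complex.Re `|C (T t x)| ^+ 2)%:E <= (k * complex.Re `|x| ^+ 2)%:E)%E.

Definition well_posed_triple (R : realType) (X U : hilbertType R)
    (A : unbounded_operator X) (B : U -> X) (C : X -> U) : Prop :=
  exists T H,
    [/\ generates A T, admissible_control T B, admissible_observation A T C,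
        transfer_function A B C H
      & exists a m : R, forall s, a < complex.Re s -> resolvent_set A s /\
          forall v, `|H s v| <= m%:C%C * `|v| ].

Section Grushin.
Context (R : realType) (X H2 Hm Hp : hilbertType R).
(* The space H1 is the subspace D of X equipped with the norm N. *)
Context (D : set X) (N : X -> R[i]) (P : X -> H2) (Rm : Hm -> H2) (Rp : X -> Hp).

Definition grushin_op (p : X * Hm) : H2 * Hp := (P p.1 + Rm p.2, Rp p.1).

Definition block_op (E : H2 -> X) (Ep : Hp -> X) (Em : H2 -> Hm)
  (Emp : Hp -> Hm) (q : H2 * Hp) : X * Hm := (E q.1 + Ep q.2, Em q.1 + Emp q.2).

Definition bounded_into (V : normedModType R[i]) (f : V -> X) : Prop :=
  [/\ linear f, forall v, D (f v) &
      exists m : R[i], forall v, N (f v) <= m * `|v|].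

Definition grushin_inverse (E : H2 -> X) (Ep : Hp -> X) (Em : H2 -> Hm)
    (Emp : Hp -> Hm) : Prop :=
  [/\ bounded_into E /\ bounded_into Ep,
      bounded_operator Em /\ bounded_operator Emp,
      forall q, grushin_op (block_op E Ep Em Emp q) = q
    & forall p, D p.1 -> block_op E Ep Em Emp (grushin_op p) = p].

Definition grushin_well_posed : Prop :=
  exists E Ep Em Emp, grushin_inverse E Ep Em Emp.

Definition effective_hamiltonian (Emp : Hp -> Hm) : Prop :=
  exists E Ep Em, grushin_inverse E Ep Em Emp.

End Grushin.

(* Main.v *)
From HB Require Import structures.
Require Import Defs.
From mathcomp Require Import all_boot all_order all_algebra.
From mathcomp Require Import complex.
From mathcomp Require Import all_classical all_reals all_analysis.
From mathcomp Require Import measurable_realfun.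
From mathcomp Require Import ring lra.

(** Write R(s) = (s - A)^-1. Eliminating u from the first equation of the Grushin
    problem turns the second one into
      B* R(lambda) B u_- = B* R(lambda) v - v_+,
    so everything follows, by a Schur complement computation
    ([grushin_solution], [schur_grushin_inverse]), once B* R(lambda) B is known to
    be H(lambda), which is invertible by assumption: the corner E_{-+} of the
    inverse is then - H(lambda)^-1.

    The substance is therefore [transfer_function_resolvent]: H(s) = B* R(s) B on
    the whole resolvent set. By the resolvent identity both sides satisfy the same
    difference relation, hence differ by a constant operator, and it suffices to
    compare them at one point on one trajectory for each vector v. The trajectory
    is driven by u(t) = (2 e^(-2t) - e^(-t)) v. With b = B v it is
      z(t) = 2 e^(-2t) R(-2) b - e^(-t) R(-1) b - T(t) A p,   p = R(-1) b - R(-2) b,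
    where T is the semigroup generated by A. Since the input has integral zero,
    the coefficient of T(t) is in the range of A, and z has the primitive
      e^(-t) R(-1) b - e^(-2t) R(-2) b - T(t) p,
    which shows that z is a mild solution ([test_state_solution]) without ever
    constructing a vector-valued integral. The Laplace transforms of u and of B* z
    at a large real s are computed from explicit primitives of the scalar
    functions obtained by pairing with fixed vectors ([laplace_test_input],
    [laplace_test_output]); they are h v and h B* R(s) B v for one nonzero
    number h.

    Two facts from functional analysis support this. A skew-adjoint A has every
    nonzero real number in its resolvent set ([skew_resolvent]), which rests on
    the projection theorem ([orthogonal_trivial_full]). And orbits of a strongly
    continuous semigroup are continuous and exponentially bounded, and
    differentiable from both sides on the domain of A ([semigroup_continuous],
    [semigroup_exp_bound], [semigroup_is_derive]), which rests on the uniform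
    boundedness principle ([uniform_boundedness]). *)

Set Implicit Arguments.
Unset Strict Implicit.
Unset Printing Implicit Defensive.
Import Order.TTheory GRing.Theory Num.Theory.
Import numFieldNormedType.Exports.
Import HBNNSimple.
Local Open Scope classical_set_scope.
Local Open Scope ring_scope.

(** * Hilbert spaces seen through the real inner product *)

Section RealInner.
Context {R : realType}.
Implicit Types X : hilbertType R.

(** Over a complex space the real part of the inner product is a real inner
    product with the same norm; working with it keeps derivatives, integrals and
    estimates inside R. Nothing is lost, by [innerE]. *)
Definition rdot {X} (x y : X) : R := complex.Re (inner x y).
Definition rnorm {X} (x : X) : R := complex.Re `|x|.

Lemma innerDl X (x y z : X) : inner (x + y) z = inner x z + inner y z.
Proof. by rewrite /inner linearDl. Qed.
Lemma innerDr X (x y z : X) : inner z (x + y) = inner z x + inner z y.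
Proof. by rewrite /inner linearDr. Qed.
Lemma innerZl X (a : R[i]) (x y : X) : inner (a *: x) y = a * inner x y.
Proof. by rewrite /inner linearZl_LR. Qed.
Lemma innerZr X (a : R[i]) (x y : X) :
  inner x (a *: y) = (conjc a) * inner x y.
Proof. by rewrite /inner linearZr_LR. Qed.
Lemma innerC X (x y : X) : inner x y = conjc (inner y x).
Proof. by rewrite /inner hermC expr0 mul1r. Qed.
Lemma rnormE X (x : X) : `|x| = (rnorm x)%:C%C.
Proof. by rewrite RRe_real// normr_real. Qed.
(** Conjugate linearity in the second argument: the imaginary part of
    the inner product with y is its real part with i y. *)
Lemma innerE X (x y : X) : inner x y = Complex (rdot x y) (rdot x ('i%C *: y)).
Proof.
rewrite /rdot innerZr; case: (inner x y) => a b /=.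
by congr Complex; ring.
Qed.

Lemma rdotC X (x y : X) : rdot x y = rdot y x.
Proof. by rewrite /rdot innerC; case: (inner y x). Qed.
Lemma rdotDl X (x y z : X) : rdot (x + y) z = rdot x z + rdot y z.
Proof. by rewrite /rdot innerDl raddfD. Qed.
Lemma rdotDr X (x y z : X) : rdot z (x + y) = rdot z x + rdot z y.
Proof. by rewrite /rdot innerDr raddfD. Qed.
Lemma rdotZl X (a : R) (x y : X) : rdot (a%:C%C *: x) y = a * rdot x y.
Proof. by rewrite /rdot innerZl; case: (inner x y) => b c /=; ring. Qed.
Lemma rdotZr X (a : R) (x y : X) : rdot x (a%:C%C *: y) = a * rdot x y.
Proof. by rewrite rdotC rdotZl rdotC. Qed.
Lemma rdotNl X (x y : X) : rdot (- x) y = - rdot x y.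
Proof. by rewrite -scaleN1r -(rmorphN1 (real_complex R)) rdotZl mulN1r. Qed.
Lemma rdotNr X (x y : X) : rdot x (- y) = - rdot x y.
Proof. by rewrite rdotC rdotNl rdotC. Qed.
Lemma rdotBl X (x y z : X) : rdot (x - y) z = rdot x z - rdot y z.
Proof. by rewrite rdotDl rdotNl. Qed.
Lemma rdotBr X (x y z : X) : rdot z (x - y) = rdot z x - rdot z y.
Proof. by rewrite rdotDr rdotNr. Qed.
Lemma rdot0l X (y : X) : rdot 0 y = 0.
Proof. by rewrite -(subrr y) rdotBl subrr. Qed.

Lemma rnorm_ge0 X (x : X) : 0 <= rnorm x.
Proof. by rewrite -ler0c -rnormE. Qed.
Lemma rnorm0 X : rnorm (0 : X) = 0.
Proof. by rewrite /rnorm normr0. Qed.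
Lemma rnorm_sqr X (x : X) : rnorm x ^+ 2 = rdot x x.
Proof.
have := hilbert_norm x; rewrite rnormE -rmorphXn => h.
by rewrite /rdot /inner -h.
Qed.
Lemma rnorm_eq0 X (x : X) : rnorm x = 0 -> x = 0.
Proof. by move=> h; apply/eqP; rewrite -normr_eq0 rnormE h. Qed.
Lemma rnormD X (x y : X) : rnorm (x + y) <= rnorm x + rnorm y.
Proof. by rewrite -lecR rmorphD/= -!rnormE ler_normD. Qed.
Lemma rnormN X (x : X) : rnorm (- x) = rnorm x.
Proof. by rewrite /rnorm normrN. Qed.
Lemma rnormB X (x y : X) : rnorm (x - y) <= rnorm x + rnorm y.
Proof. by rewrite (le_trans (rnormD _ _))// rnormN. Qed.
Lemma rnorm_distC X (x y : X) : rnorm (x - y) = rnorm (y - x).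
Proof. by rewrite -rnormN opprB. Qed.
Lemma rnormZ X (a : R) (x : X) : rnorm (a%:C%C *: x) = `|a| * rnorm x.
Proof.
rewrite [LHS]/rnorm normrZ rnormE.
have -> : `|a%:C%C| = `|a|%:C%C :> R[i].
  by rewrite normc_def /= expr0n addr0 sqrtr_sqr.
by rewrite -(rmorphM (real_complex R)).
Qed.

Lemma rdot_ext X (x y : X) : (forall w, rdot x w = rdot y w) -> x = y.
Proof.
move=> h; apply/eqP; rewrite -subr_eq0; apply/eqP/rnorm_eq0/eqP.
by rewrite -sqrf_eq0 rnorm_sqr rdotBl h subrr.
Qed.

(** Cauchy-Schwarz: expand the square norm of x minus its projection on y. *)
Lemma rdot_le X (x y : X) : `|rdot x y| <= rnorm x * rnorm y.
Proof.
have [->|y0] := eqVneq y 0; first by rewrite rdotC rdot0l rnorm0 normr0 mulr0.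
have yp : 0 < rnorm y.
  rewrite lt_neqAle rnorm_ge0 andbT eq_sym; apply: contra_neq y0.
  exact: rnorm_eq0.
rewrite -(@ler_pXn2r _ 2%N)// ?nnegrE ?mulr_ge0 ?rnorm_ge0//.
rewrite real_normK ?num_real// exprMn.
set p := rdot x y; set a := p / rnorm y ^+ 2.
have := sqr_ge0 (rnorm (x - a%:C%C *: y)).
rewrite rnorm_sqr rdotBl !rdotBr rdotZl !rdotZr rdotZl (rdotC y x) -!rnorm_sqr -/p.
move/(fun h => mulr_ge0 h (sqr_ge0 (rnorm y))); rewrite /a.
set X2 := rnorm x ^+ 2; set Y2 := rnorm y ^+ 2.
have Yn : Y2 != 0 by rewrite /Y2 sqrf_eq0 gt_eqF.
set Z := (X in 0 <= X -> _); have -> : Z = X2 * Y2 - p ^+ 2 by rewrite /Z; field.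
by rewrite subr_ge0.
Qed.
End RealInner.

Section Convergence.
Context {R : realType}.
Implicit Types X Y : hilbertType R.

Lemma cvg_rnormP {T : Type} {F : set_system T} {FF : Filter F} X
    (f : T -> X) (l : X) :
  f @ F --> l <-> forall e : R, 0 < e -> \forall t \near F, rnorm (l - f t) < e.
Proof.
split=> [/cvgrPdist_lt fl e e0|h].
  have /fl : 0 < e%:C%C :> R[i] by rewrite ltcR.
  by apply: filterS => t; rewrite rnormE ltcR.
apply/cvgrPdist_lt => e e0.
have eE : e = (complex.Re e)%:C%C by rewrite RRe_real// gtr0_real.
have := h (complex.Re e); rewrite -ltcR -eE => /(_ e0).
by apply: filterS => t; rewrite rnormE eE ltcR.
Qed.

Lemma cvg_rdotl {T : Type} {F : set_system T} {FF : Filter F} X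
    (f : T -> X) (l y : X) :
  f @ F --> l -> (fun t => rdot (f t) y) @ F --> rdot l y.
Proof.
move=> /cvg_rnormP fl; apply/cvgrPdist_lt => e e0.
have yp : 0 < rnorm y + 1 by rewrite ltr_wpDl ?rnorm_ge0.
have /fl : 0 < e / (rnorm y + 1) by rewrite divr_gt0.
apply: filterS => t; rewrite ltr_pdivlMr// -rdotBl; apply: le_lt_trans.
rewrite (le_trans (rdot_le _ _))// ler_wpM2l ?rnorm_ge0// lerDl//.
Qed.

Lemma cvg_rnorm {T : Type} {F : set_system T} {FF : Filter F} X
    (f : T -> X) (l : X) :
  f @ F --> l -> (fun t => rnorm (f t)) @ F --> rnorm l.
Proof.
move=> /cvg_rnormP fl; apply/cvgrPdist_lt => e /fl.
apply: filterS => t; apply: le_lt_trans.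
have h1 := rnormD (l - f t) (f t); have h2 := rnormD (f t - l) l.
rewrite !subrK in h1 h2; rewrite (rnorm_distC (f t)) in h2.
by rewrite ler_norml; apply/andP; split; lra.
Qed.

Lemma rnorm_complete X (x : nat -> X) :
  (forall e : R, 0 < e -> exists N : nat, forall m n, (N <= m)%N -> (N <= n)%N ->
     rnorm (x m - x n) < e) -> exists l : X, x @ \oo --> l.
Proof.
move=> h; suff /cvg_ex : cvg (x @ \oo) by [].
apply/cauchy_cvgP/cauchy_ballP => e e0.
have eE : e = (complex.Re e)%:C%C by rewrite RRe_real// gtr0_real.
have [|N hN] := h (complex.Re e); first by rewrite -ltcR -eE.
rewrite near_simpl; exists ([set n | (N <= n)%N], [set n | (N <= n)%N]) => /=.
  by split; exists N.
move=> [m n] /= [Nm Nn]; rewrite -ball_normE /ball_ /= rnormE eE ltcR.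
exact: hN.
Qed.

Lemma linear_fun0 X Y (f : X -> Y) : linear f -> f 0 = 0.
Proof.
by move=> lf; have := lf (-1) 0 0; rewrite !scaleN1r oppr0 addr0 addNr.
Qed.
Lemma linear_funD X Y (f : X -> Y) x y : linear f -> f (x + y) = f x + f y.
Proof. by move=> lf; have := lf 1 x y; rewrite !scale1r. Qed.
Lemma linear_funZ X Y (f : X -> Y) a x : linear f -> f (a *: x) = a *: f x.
Proof.
by move=> lf; have := lf a x 0; rewrite !addr0 linear_fun0// addr0.
Qed.
Lemma linear_funN X Y (f : X -> Y) x : linear f -> f (- x) = - f x.
Proof. by move=> lf; rewrite -scaleN1r linear_funZ// scaleN1r. Qed.
Lemma linear_funB X Y (f : X -> Y) x y : linear f -> f (x - y) = f x - f y.
Proof. by move=> lf; rewrite linear_funD// linear_funN. Qed.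

Definition packlin X Y (f : X -> Y) (lf : linear f) : {linear X -> Y} :=
  HB.pack f (GRing.isLinear.Build _ _ _ _ _ lf).

Lemma bounded_operatorP X Y (f : X -> Y) :
  bounded_operator f <->
  linear f /\ exists2 m : R, 0 < m & forall x, rnorm (f x) <= m * rnorm x.
Proof.
split=> [[lf cf]|[lf [m m0 fm]]]; split=> //.
  have /(continuous_linear_bounded (0 : X)) : {for 0, continuous (packlin lf)} by exact: cf.
  move=> /linear_boundedP -[M [Mr fM]].
  exists (`|complex.Re M| + 1) => [|x]; first by rewrite ltr_wpDl.
  have /fM/(_ x) : M < (`|complex.Re M| + 1)%:C%C.
    rewrite -[M]RRe_real// ltcR /=; have := ler_norm (complex.Re M); lra.
  by rewrite !rnormE -rmorphM lecR.
apply: (@bounded_linear_continuous _ _ _ (packlin lf)).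
apply/linear_boundedP; exists m%:C%C; split.
  by rewrite ger0_real// ler0c ltW.
move=> r mr x; rewrite !rnormE.
rewrite (@le_trans _ _ (m%:C%C * (rnorm x)%:C%C))//.
  by rewrite -rmorphM lecR.
by rewrite ler_wpM2r ?ler0c ?rnorm_ge0// ltW.
Qed.

End Convergence.


(** * Completeness: orthogonality and uniform boundedness *)

Section HilbertGeometry.
Context {R : realType}.
Implicit Types X Y : hilbertType R.

(** The projection theorem, in the only form in which it is used: a
    minimising sequence for the distance to x is Cauchy by the parallelogram
    identity, and x minus its limit is orthogonal to C, hence zero. *)
Lemma orthogonal_trivial_full X (C : set X) :
  C 0 ->
  (forall (a : R) x y, C x -> C y -> C (a%:C%C *: x + y)) ->
  (forall (x : nat -> X) l, (forall n, C (x n)) -> x @ \oo --> l -> C l) ->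
  (forall y, (forall c, C c -> rdot c y = 0) -> y = 0) ->
  forall x, C x.
Proof.
move=> C0 Clin Ccl Corth x.
pose D := [set rnorm (x - c) | c in C].
have D_lb : lbound D 0 by move=> _ [c _ <-]; exact: rnorm_ge0.
have D_inf : has_inf D by split; [exists (rnorm (x - 0)), 0 | exists 0].
pose d := inf D.
have d_le c : C c -> d <= rnorm (x - c).
  by move=> Cc; apply: ge_inf; [exists 0 | exists c].
have d0 : 0 <= d by apply: lb_le_inf D_lb; case: D_inf.
have ex_c (n : nat) : exists c, C c /\ rnorm (x - c) < d + n.+1%:R^-1.
  have : 0 < n.+1%:R^-1 :> R by rewrite invr_gt0 ltr0n.
  by move=> /inf_adherent/(_ D_inf)[_ [c Cc <-] h]; exists c.
have /choice[c cP] := ex_c.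
have close a m n : 0 < a -> rnorm (x - c m) < d + a -> rnorm (x - c n) < d + a ->
    rnorm (c m - c n) ^+ 2 <= 4 * (2 * d * a + a ^+ 2).
  move=> a0 hm hn.
  have Cmid : C (2^-1%:C%C *: c m + (2^-1%:C%C *: c n + 0)).
    by have [[? _] [? _]] := (cP m, cP n); do 2?apply: (Clin).
  have := d_le _ Cmid; rewrite addr0 => hmid.
  have hmid2 : d ^+ 2 <= rnorm (x - (2^-1%:C%C *: c m + 2^-1%:C%C *: c n)) ^+ 2.
    by rewrite lerXn2r// nnegrE// rnorm_ge0.
  have hm2 : rnorm (x - c m) ^+ 2 <= (d + a) ^+ 2.
    by rewrite lerXn2r// ?nnegrE ?rnorm_ge0// ?ltW// ltr_wpDl.
  have hn2 : rnorm (x - c n) ^+ 2 <= (d + a) ^+ 2.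
    by rewrite lerXn2r// ?nnegrE ?rnorm_ge0// ?ltW// ltr_wpDl.
  move: hmid2 hm2 hn2; rewrite !rnorm_sqr.
  rewrite !(rdotBl, rdotBr, rdotDl, rdotDr, rdotZl, rdotZr).
  rewrite (rdotC x (c n)) (rdotC x (c m)) (rdotC (c n) (c m)).
  lra.
have cvg_inv a : 0 < a -> exists N : nat, forall n, (N <= n)%N -> rnorm (x - c n) < d + a.
  move=> a0; have [N _ hN] := @near_infty_natSinv_lt R (PosNum a0).
  exists N => n /hN /= h; case: (cP n) => _ /lt_trans; apply.
  by rewrite ltrD2l.
have [|y cy] := @rnorm_complete R X c.
  move=> e e0.
  (* Makes 4 (2 d a + a^2) <= 4 a (2 d + 1) smaller than e^2. *)
  pose a := Num.min 1 (e ^+ 2 / (8 * d + 8)).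
  have d8 : 0 < 8 * d + 8 by lra.
  have a0 : 0 < a by rewrite lt_min ltr01/= divr_gt0// exprn_gt0.
  have [N hN] := cvg_inv a a0; exists N => m n /hN hm /hN hn.
  rewrite -(@ltr_pXn2r _ 2%N)// ?nnegrE ?rnorm_ge0 ?ltW//.
  rewrite (le_lt_trans (close _ _ _ a0 hm hn))//.
  have a1 : a <= 1 by rewrite ge_min lexx.
  have ae : a * (8 * d + 8) <= e ^+ 2.
    by rewrite -ler_pdivlMr// ge_min lexx orbT.
  nra.
have Cy : C y by apply: Ccl cy => n; case: (cP n).
suff -> : x = y by [].
have xy_d : rnorm (x - y) <= d.
  have h : (fun n => x - c n) @ \oo --> x - y by apply: cvgB => //; exact: cvg_cst.
  apply/ler_addgt0Pr => e e0; have [N hN] := cvg_inv e e0.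
  apply: (@closed_cvg _ _ _ eventually_filter (fun n => rnorm (x - c n)) [set r | r <= d + e]).
  - exact: closed_le.
  - by exists N => // n /hN/ltW.
  - exact: cvg_rnorm h.
apply/eqP; rewrite -subr_eq0; apply/eqP; apply: Corth => c' Cc'.
set p := rdot c' (x - y).
set q := rnorm c' ^+ 2 + 1.
have q0 : 0 < q by rewrite ltr_wpDl// sqr_ge0.
(* Moving y along c' by nearly the projection coefficient, + 1 in q avoiding a division by 0. *)
have Cz : C ((p / q)%:C%C *: c' + y) by exact: Clin.
have : rnorm (x - y) ^+ 2 <= rnorm (x - y - (p / q)%:C%C *: c') ^+ 2.
  rewrite lerXn2r ?nnegrE ?rnorm_ge0//.
  by rewrite (le_trans xy_d)// (le_trans (d_le _ Cz))// opprD addrA addrAC.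
move: (x - y) @p Cz => w p _.
rewrite [X in _ <= X]rnorm_sqr !(rdotBl, rdotBr) !rdotZl !rdotZr (rdotC w c').
rewrite -!rnorm_sqr -/p (_ : rnorm c' ^+ 2 = q - 1); last by rewrite /q addrK.
set t := p / q; have tq : t * q = p by rewrite /t divfK// gt_eqF.
rewrite -tq => h; suff -> : t = 0 by rewrite mul0r.
apply/eqP; rewrite -sqrf_eq0 eq_le sqr_ge0 andbT.
rewrite -(ler_pM2r q0) mul0r; nra.
Qed.

(** If the family is not uniformly bounded, then some member exceeds k
    somewhere in every ball, and by continuity on a whole smaller ball. *)
Lemma exceed_on_ball X (T : nat -> X -> X) :
  (forall n, bounded_operator (T n)) ->
  ~ (exists M : R, forall n x, rnorm (T n x) <= M * rnorm x) ->
  forall (k : R) x r, 0 < r -> exists n y s, [/\ 0 < s, s <= r / 2,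
    (forall z, rnorm (z - y) <= s -> rnorm (z - x) <= r)
    & forall z, rnorm (z - y) <= s -> k < rnorm (T n z)].
Proof.
move=> Tb Tunb k x r r0.
have [n [y [yx ky]]] : exists n y, rnorm (y - x) < r /\ k < rnorm (T n y).
  apply: contrapT => hno; apply: Tunb; exists (4 * k / r) => n w.
  have hk y : rnorm (y - x) < r -> rnorm (T n y) <= k.
    by move=> yx; rewrite leNgt; apply/negP => ky; apply: hno; exists n, y.
  have /bounded_operatorP[lT _] := Tb n.
  have k0 : 0 <= k.
    by rewrite (le_trans (rnorm_ge0 (T n x)))// hk// subrr rnorm0.
  have [->|w0] := eqVneq w 0; first by rewrite linear_fun0// !rnorm0 mulr0.
  have wp : 0 < rnorm w.
    rewrite lt_neqAle rnorm_ge0 andbT eq_sym; apply: contra_neq w0.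
    exact: rnorm_eq0.
  pose a := r / (2 * rnorm w).
  have a0 : 0 < a by rewrite divr_gt0// mulr_gt0.
  have h1 : rnorm (T n (a%:C%C *: w + x)) <= k.
    apply: hk; rewrite addrK rnormZ gtr0_norm// /a invfM mulrA divfK ?gt_eqF//.
    lra.
  have h2 : rnorm (T n x) <= k by rewrite hk// subrr rnorm0.
  have := rnormB (T n (a%:C%C *: w + x)) (T n x).
  rewrite -linear_funB// addrK linear_funZ// rnormZ gtr0_norm// => h3.
  rewrite -(ler_pM2l a0) (le_trans h3)// (le_trans (lerD h1 h2))//.
  rewrite /a le_eqVlt; apply/orP; left; apply/eqP; field.
  by rewrite !gt_eqF.
have /bounded_operatorP[lT [m m0 hm]] := Tb n.
pose s := Num.min (Num.min (r - rnorm (y - x)) (r / 2))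
                  ((rnorm (T n y) - k) / (2 * m)).
exists n, y, s; split.
- by rewrite !lt_min subr_gt0 yx !divr_gt0// ?subr_gt0// mulr_gt0.
- by rewrite !ge_min lexx orbT.
- move=> z zs; rewrite -(subrKA y) (le_trans (rnormD _ _))//.
  by rewrite -lerBrDr (le_trans zs)// !ge_min lexx.
- move=> z zs.
  have h : rnorm (T n y) <= rnorm (T n z) + m * s.
    rewrite -[y in rnorm (T n y)](subKr z) linear_funB// (le_trans (rnormB _ _))//.
    by rewrite lerD2l (le_trans (hm _))// ler_pM2l.
  have : s <= (rnorm (T n y) - k) / (2 * m) by rewrite !ge_min lexx !orbT.
  by rewrite ler_pdivlMr ?mulr_gt0// => ?; nra.
Qed.

(** The uniform boundedness principle: iterating [exceed_on_ball] gives nested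
    balls on which members of the family exceed 1, 2, 3 and so on, and the family
    is unbounded at their common point. *)
Lemma uniform_boundedness X (T : nat -> X -> X) :
  (forall n, bounded_operator (T n)) ->
  (forall x, exists M : R, forall n, rnorm (T n x) <= M) ->
  exists M : R, forall n x, rnorm (T n x) <= M * rnorm x.
Proof.
move=> Tb Tpt; apply: contrapT => /(exceed_on_ball Tb) step.
have /choice[f fP] : forall kb : nat * (X * {posnum R}),
    exists b : X * {posnum R}, [/\ b.2%:num <= kb.2.2%:num / 2,
      (forall z, rnorm (z - b.1) <= b.2%:num -> rnorm (z - kb.2.1) <= kb.2.2%:num)
      & exists n, forall z, rnorm (z - b.1) <= b.2%:num -> kb.1%:R < rnorm (T n z)].
  move=> [k [x r]]; have [n [y [s [s0 sr sub big]]]] := step k%:R x r%:num [gt0 of r%:num].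
  by exists (y, PosNum s0); split => //=; exists n.
pose b := fix b k := if k is k'.+1 then f (k', b k') else (0 : X, PosNum (@ltr01 R)).
have nest m n z : (m <= n)%N -> rnorm (z - (b n).1) <= (b n).2%:num ->
    rnorm (z - (b m).1) <= (b m).2%:num.
  move=> /subnKC <-; elim: (n - m)%N => [|k IH]; first by rewrite addn0.
  by rewrite addnS => h; apply: IH; case: (fP ((m + k)%N, b (m + k)%N)) => _ /(_ z h).
have rad n : (b n).2%:num <= 2 ^- n :> R.
  elim: n => [|n IH]; first by rewrite /= expr0 invr1.
  case: (fP (n, b n)) => /= + _ _ => /le_trans; apply.
  by rewrite exprS invfM mulrC ler_pM2l ?invr_gt0.
have ctr m n : (m <= n)%N -> rnorm ((b n).1 - (b m).1) <= (b m).2%:num.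
  by move=> mn; apply: nest mn _; rewrite subrr rnorm0.
have [|x bx] := @rnorm_complete R X (fun n => (b n).1).
  move=> e e0; have e20 : 0 < e / 2 by rewrite divr_gt0.
  have [N _ hN] := @near_infty_natSinv_expn_lt R (PosNum e20).
  exists N => m n Nm Nn; rewrite -(subrKA (b N).1) (le_lt_trans (rnormD _ _))//.
  have := ctr _ _ Nm; have := ctr _ _ Nn; have := rad N; have := hN N (leqnn N).
  rewrite /= (rnorm_distC (b N).1) div1r; lra.
have xin m : rnorm (x - (b m).1) <= (b m).2%:num.
  have h : (fun n => (b n).1 - (b m).1) @ \oo --> x - (b m).1.
    by apply: cvgB => //; exact: cvg_cst.
  apply: (@closed_cvg _ _ _ eventually_filter
    (fun n => rnorm ((b n).1 - (b m).1)) [set r | r <= (b m).2%:num]).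
  - exact: closed_le.
  - by exists m => // n /ctr.
  - exact: cvg_rnorm h.
have [M hM] := Tpt x.
set K := (Num.truncn M).+1; have [_ _ [n /(_ x (xin K.+1)) /=]] := fP (K, b K).
apply/negP; rewrite -leNgt (le_trans (hM n))// ltW//.
exact: Num.Theory.real_truncnS_gt (num_real M).
Qed.
End HilbertGeometry.

(** * Skew-adjoint operators and their resolvents *)

Section SkewAdjoint.
Context {R : realType} {X : hilbertType R} {A : unbounded_operator X}.

Lemma op0 : A 0 = 0.
Proof.
have := opP (u := A) (-1) (dom0 A) (dom0 A).
by rewrite !scaleN1r oppr0 addr0 addNr.
Qed.
Lemma domZ (a : R[i]) x : dom A x -> dom A (a *: x).
Proof. by move=> dx; rewrite -[a *: x]addr0; exact: domP (dom0 A). Qed.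
Lemma domD x y : dom A x -> dom A y -> dom A (x + y).
Proof. by move=> dx dy; rewrite -[x]scale1r; exact: domP. Qed.
Lemma domN x : dom A x -> dom A (- x).
Proof. by move=> dx; rewrite -scaleN1r; exact: domZ. Qed.
Lemma domB x y : dom A x -> dom A y -> dom A (x - y).
Proof. by move=> dx dy; apply: domD dx (domN dy). Qed.
Lemma opZ (a : R[i]) x : dom A x -> A (a *: x) = a *: A x.
Proof. by move=> dx; have := opP (u := A) a dx (dom0 A); rewrite op0 !addr0. Qed.
Lemma opD x y : dom A x -> dom A y -> A (x + y) = A x + A y.
Proof. by move=> dx dy; have := opP (u := A) 1 dx dy; rewrite !scale1r. Qed.
Lemma opN x : dom A x -> A (- x) = - A x.
Proof. by move=> dx; rewrite -scaleN1r opZ// scaleN1r. Qed.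
Lemma opB x y : dom A x -> dom A y -> A (x - y) = A x - A y.
Proof. by move=> dx dy; rewrite opD ?opN//; exact: domN. Qed.

Lemma resolvent_ofP s : resolvent_set A s -> resolvent_of A s (resolvent A s).
Proof.
move=> [F hF].
by apply: (@xgetPex _ (fun=> 0) [set G | resolvent_of A s G]); exists F.
Qed.

Hypothesis skewA : skew_adjoint A.

(** Testing against i x recovers the imaginary part, so real parts decide
    membership in the graph of the adjoint. *)
Lemma rdot_adjoint_graph y w :
  (forall x, dom A x -> rdot (A x) y = rdot x w) -> adjoint_graph A y w.
Proof.
move=> h x dx; rewrite !innerE; congr Complex; first exact: h.
have rot (u v : X) : rdot u ('i%C *: v) = rdot ((- 'i%C) *: u) v.
  rewrite /rdot innerZl innerZr.
  by case: (inner u v) => a b /=; ring.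
by rewrite !rot -opZ// h//; exact: domZ.
Qed.

Lemma skew_rdot x y : dom A x -> dom A y -> rdot (A x) y = - rdot x (A y).
Proof.
move=> dx dy; have /skewA.2 h : dom A y /\ - A y = - A y by [].
by rewrite -rdotNr /rdot h.
Qed.

Lemma skew_rdot0 x : dom A x -> rdot (A x) x = 0.
Proof.
move=> dx; have := skew_rdot dx dx; rewrite (rdotC x) => h; lra.
Qed.

Lemma skew_adjointP y w :
  (forall x, dom A x -> rdot (A x) y = rdot x w) -> dom A y /\ A y = - w.
Proof.
by move=> /rdot_adjoint_graph/skewA.2[dy ->]; rewrite opprK.
Qed.

(** The graph of A is closed because it is the graph of an adjoint. *)
Lemma skew_closed (x : nat -> X) l m : (forall n, dom A (x n)) ->
  x @ \oo --> l -> (fun n => A (x n)) @ \oo --> m -> dom A l /\ A l = m.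
Proof.
move=> dx xl Axm; rewrite -[m]opprK; apply: skew_adjointP => v dv.
rewrite rdotNr ![rdot _ l]rdotC ![rdot _ m]rdotC.
have h1 : (fun n => rdot (x n) (A v)) @ \oo --> rdot l (A v) by exact: cvg_rdotl.
have h2 : (fun n => rdot (x n) (A v)) @ \oo --> - rdot m v.
  have -> : (fun n => rdot (x n) (A v)) = (fun n => - rdot (A (x n)) v).
    by apply/funext => n; rewrite skew_rdot// opprK.
  by apply: cvgN; exact: cvg_rdotl.
by rewrite -(cvg_lim _ h1)// (cvg_lim _ h2).
Qed.

(** The cross term in the square norm of mu x - A x is <A x, x>, whose real
    part vanishes. *)
Lemma skew_coercive (mu : R) x : dom A x ->
  `|mu| * rnorm x <= rnorm (mu%:C%C *: x - A x).
Proof.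
move=> dx; rewrite -(@ler_pXn2r _ 2%N)// ?nnegrE ?mulr_ge0 ?rnorm_ge0//.
rewrite exprMn real_normK ?num_real// [X in _ <= X]rnorm_sqr.
rewrite !(rdotBl, rdotBr) !rdotZl !rdotZr (rdotC x (A x)) skew_rdot0// -!rnorm_sqr.
by have := sqr_ge0 (rnorm (A x)); lra.
Qed.

(** Coercivity makes mu - A injective with closed range. A vector y orthogonal to
    the range lies in the domain of the adjoint -A with A y = - mu y, and then
    <A y, y> = 0 forces y = 0; so the range is everything. Both signs of mu are
    needed later: the negative ones give decaying inputs and the weak adjoint of
    the resolvent at positive points. *)
Lemma skew_resolvent (mu : R) : mu != 0 -> resolvent_set A mu%:C%C.
Proof.
move=> mu0; pose P x := mu%:C%C *: x - A x.
have mup : 0 < `|mu| by rewrite normr_gt0.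
have Plin a x y : dom A x -> dom A y -> P (a *: x + y) = a *: P x + P y.
  move=> dx dy; rewrite /P opP// scalerDr scalerBr !scalerA (mulrC a).
  by rewrite opprD addrACA.
have PB x y : dom A x -> dom A y -> P x - P y = P (x - y).
  by move=> dx dy; rewrite addrC -scaleN1r -Plin// scaleN1r addrC.
have Pinj x y : dom A x -> dom A y -> P x = P y -> x = y.
  move=> dx dy Pxy; apply/eqP; rewrite -subr_eq0; apply/eqP/rnorm_eq0/eqP.
  rewrite eq_le rnorm_ge0 andbT -(ler_pM2l mup) mulr0.
  by rewrite (le_trans (skew_coercive mu (domB dx dy)))// -/(P _) -PB// Pxy subrr rnorm0.
have Psurj y : exists x, dom A x /\ P x = y.
  move: y; apply: orthogonal_trivial_full.
  - by exists 0; split; [exact: dom0 | rewrite /P op0 scaler0 subr0].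
  - move=> a _ _ [x [dx <-]] [y [dy <-]]; exists (a%:C%C *: x + y).
    by split; [exact: domP | exact: Plin].
  - move=> y l /choice[x hx] yl.
    have xP n : P (x n) = y n by case: (hx n).
    have xd n : dom A (x n) by case: (hx n).
    have [|z xz] := @rnorm_complete R X x.
      move=> e e0; have /cvg_rnormP yl' := yl.
      have [|N _ hN] := yl' (`|mu| * e / 2); first by rewrite divr_gt0// mulr_gt0.
      exists N => m n /hN /= hm /hN /= hn; rewrite -(ltr_pM2l mup).
      rewrite (le_lt_trans (skew_coercive mu (domB (xd m) (xd n))))// -/(P _) -PB// !xP.
      rewrite -(subrKA l) (le_lt_trans (rnormD _ _))// (rnorm_distC _ l).
      lra.
    have Axz : (fun n => A (x n)) @ \oo --> mu%:C%C *: z - l.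
      have -> : (fun n => A (x n)) = (fun n => mu%:C%C *: x n - y n).
        by apply/funext => n; rewrite -xP /P opprB addrC subrK.
      by apply: cvgB => //; apply: cvgZr.
    have [dz Az] := skew_closed xd xz Axz.
    by exists z; rewrite /P Az opprB addrC subrK.
  - move=> y hy.
    have hy' x : dom A x -> rdot (A x) y = rdot x (mu%:C%C *: y).
      move=> dx; have : rdot (P x) y = 0 by apply: hy; exists x.
      by rewrite /P rdotBl rdotZl rdotZr => /eqP; rewrite subr_eq0 => /eqP.
    have [dy Ay] := skew_adjointP hy'.
    have := skew_rdot0 dy; rewrite Ay rdotNl rdotZl => /eqP.
    rewrite oppr_eq0 mulf_eq0 (negbTE mu0) /= -rnorm_sqr sqrf_eq0 => /eqP.
    exact: rnorm_eq0.
have /choice[F hF] := Psurj.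
have FP x : P (F x) = x by case: (hF x).
have Fd x : dom A (F x) by case: (hF x).
exists F; split.
- apply/bounded_operatorP; split.
    move=> a x y; apply: Pinj; [exact: Fd | exact: domP | by rewrite Plin// !FP].
  exists `|mu|^-1; first by rewrite invr_gt0.
  move=> x; rewrite ler_pdivlMl//.
  by rewrite (le_trans (skew_coercive mu (Fd x)))// -/(P _) FP.
- by move=> x; split => //; exact: FP.
- by move=> x dx; apply: Pinj => //; rewrite FP.
Qed.

(** For real s the adjoint of (s - A)^-1 is (s + A)^-1 = - (- s - A)^-1. *)
Lemma skew_resolvent_adjoint (s : R) x y : s != 0 ->
  rdot (resolvent A s%:C%C x) y = - rdot x (resolvent A (- s)%:C%C y).
Proof.
move=> s0; have [_ Rs _] := resolvent_ofP (skew_resolvent s0).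
have Ns0 : - s != 0 by rewrite oppr_eq0.
have [_ RNs _] := resolvent_ofP (skew_resolvent Ns0).
have [dx ex] := Rs x; have [dy ey] := RNs y.
rewrite -{1}ey -{2}ex rdotBl rdotBr rdotZl rdotZr skew_rdot//.
ring.
Qed.
End SkewAdjoint.


(** * Strongly continuous semigroups *)

Section Semigroup.
Context {R : realType} {X : hilbertType R} {T : R -> X -> X}.
Hypothesis C0T : C0_semigroup T.

Let bT t : 0 <= t -> bounded_operator (T t). Proof. by case: C0T => h _ _ _; exact: h. Qed.
Let lT t : 0 <= t -> linear (T t). Proof. by move=> /bT[]. Qed.
Let T0 x : T 0 x = x. Proof. by case: C0T. Qed.
Let TD s t x : 0 <= s -> 0 <= t -> T (s + t) x = T s (T t x).
Proof. by case: C0T => _ _ h _; exact: h. Qed.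

Lemma semigroup_near0 x (e : R) : 0 < e ->
  exists2 d : R, 0 < d & forall h, 0 <= h -> h < d -> rnorm (T h x - x) < e.
Proof.
move=> e0; have [_ _ _ /(_ x)/cvg_rnormP/(_ e e0)] := C0T.
move=> [d /= d0 hd]; exists d => // h; rewrite le_eqVlt => /predU1P[<- _|h0 hd'].
  by rewrite T0 subrr rnorm0.
rewrite rnorm_distC; apply: hd => //=.
by rewrite sub0r normrN gtr0_norm.
Qed.

(** Otherwise there are times t_n tending to 0 with operator norms tending to
    infinity; but the vectors T(t_n) x converge to x, against uniform boundedness. *)
Lemma semigroup_bounded_near0 : exists d M : R, [/\ 0 < d, 0 < M &
  forall t x, 0 <= t -> t <= d -> rnorm (T t x) <= M * rnorm x].
Proof.
apply: contrapT => hno.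
have /choice[t tP] : forall n : nat, exists t, [/\ 0 <= t, t <= n.+1%:R^-1 &
    exists x, n.+1%:R * rnorm x < rnorm (T t x)].
  move=> n; apply: contrapT => hn; apply: hno; exists n.+1%:R^-1, n.+1%:R; split.
  - by rewrite invr_gt0.
  - by [].
  - move=> t x t0 tn; rewrite leNgt; apply/negP => hx; apply: hn.
    by exists t; split => //; exists x.
have t0 n : 0 <= t n by case: (tP n).
have [|M hM] := @uniform_boundedness R X (fun n => T (t n)) (fun n => bT (t0 n)).
  move=> x; have [d d0 hd] := semigroup_near0 x (@ltr01 R).
  have [N _ hN] := @near_infty_natSinv_lt R (PosNum d0).
  exists (rnorm x + 1 + \sum_(n < N) rnorm (T (t n) x)) => n.
  have s0 : 0 <= \sum_(n < N) rnorm (T (t n) x) by apply: sumr_ge0 => i _; exact: rnorm_ge0.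
  have [Nn|nN] := leqP N n.
    have /= nd := hN n Nn; have [_ tn _] := tP n.
    have := hd _ (t0 n) (le_lt_trans tn nd).
    have := rnormD (T (t n) x - x) x; rewrite subrK; lra.
  rewrite (bigD1 (Ordinal nN))//=.
  have : 0 <= \sum_(i < N | i != Ordinal nN) rnorm (T (t i) x).
    by apply: sumr_ge0 => i _; exact: rnorm_ge0.
  have := rnorm_ge0 x; lra.
have [_ _ [x]] := tP (Num.truncn M).
apply/negP; rewrite -leNgt (le_trans (hM _ _))// ler_wpM2r ?rnorm_ge0//.
by rewrite ltW// Num.Theory.real_truncnS_gt// num_real.
Qed.

Lemma semigroup_exp_bound : exists M w : R, [/\ 0 < M, 0 < w &
  forall t x, 0 <= t -> rnorm (T t x) <= M * expR (w * t) * rnorm x].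
Proof.
have [d [M [d0 M0 hM]]] := semigroup_bounded_near0.
exists (expR M), (M / d); split; [exact: expR_gt0 | exact: divr_gt0 |].
have step (n : nat) t x : 0 <= t -> t <= n%:R * d -> rnorm (T t x) <= expR (M *+ n) * rnorm x.
  elim: n t => [|n IH] t t0.
    rewrite mul0r => t0'; have -> : t = 0 by apply/eqP; rewrite eq_le t0 t0'.
    by rewrite T0 mulr0n expR0 mul1r.
  move=> tn; rewrite mulrS expRD.
  have ME : M <= expR M by have := expR_ge1Dx M; lra.
  have [td|dt] := leP t d.
    rewrite (le_trans (hM _ _ t0 td))// ler_wpM2r ?rnorm_ge0//.
    rewrite (le_trans ME)// ler_peMr ?expR_ge0// -expR0 ler_expR.
    by rewrite mulrn_wge0// ltW.
  have td0 : 0 <= t - d by rewrite subr_ge0 ltW.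
  have -> : t = d + (t - d) by rewrite addrC subrK.
  rewrite TD ?(ltW d0)// -mulrA.
  rewrite (le_trans (hM _ _ (ltW d0) (lexx _)))//.
  apply: ler_pM; rewrite ?rnorm_ge0 ?(ltW M0)//.
  apply: IH => //; rewrite lerBlDr (le_trans tn)// -natr1 mulrDl mul1r//.
move=> t x t0; rewrite (le_trans (step (Num.truncn (t / d)).+1 _ _ t0 _))//.
  by rewrite -ler_pdivrMr// ltW// Num.Theory.real_truncnS_gt// num_real.
rewrite ler_wpM2r ?rnorm_ge0// -expRD ler_expR mulrS lerD2l -mulr_natr.
rewrite -mulrA ler_pM2l// (mulrC d^-1) Num.Theory.truncn_le.
by rewrite divr_ge0// ltW.
Qed.

(** Constant extension to negative times, so that orbits become continuous on the
    whole line and no one-sided continuity has to be tracked. *)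
Definition extend_semigroup (t : R) := T (Num.max t 0).

(** Two nearby orbit points differ by T(s) (T(h) x - x), where s is the
    smaller of the two times; the exponential bound controls T(s), which is what
    continuity from the left requires. *)
Lemma semigroup_continuous x : continuous (fun t => extend_semigroup t x).
Proof.
have [M [w [M0 w0 hT]]] := semigroup_exp_bound.
move=> t; apply/cvg_rnormP => e e0; rewrite /extend_semigroup.
set a := Num.max t 0; have a0 : 0 <= a by rewrite le_max lexx orbT.
pose C := M * expR (w * (a + 1)); have C0 : 0 < C by rewrite mulr_gt0// expR_gt0.
have [|d d0 hd] := @semigroup_near0 x (e / C); first by rewrite divr_gt0.
have key s r : 0 <= s -> s <= r -> s <= a + 1 -> r - s < d -> rnorm (T r x - T s x) < e.
  move=> s0 sr sa rs; have rs0 : 0 <= r - s by rewrite subr_ge0.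
  have -> : r = s + (r - s) by rewrite addrC subrK.
  rewrite TD// -linear_funB; last exact: lT.
  rewrite (le_lt_trans (hT _ _ s0))//.
  rewrite (@le_lt_trans _ _ (C * rnorm (T (r - s) x - x)))//.
    by rewrite ler_wpM2r ?rnorm_ge0// ler_pM2l// ler_expR ler_pM2l.
  by rewrite mulrC -ltr_pdivlMr// hd.
have m0 : 0 < Num.min d 1 by rewrite lt_min d0 ltr01.
have near_a : \forall r \near t, `|a - Num.max r 0| < Num.min d 1.
  have : (fun r : R => Num.max r 0) @ t --> a.
    apply: (@continuous_max _ _ (fun r => r) (fun=> 0)); [exact: cvg_id | exact: cvg_cst].
  by move=> /cvgrPdist_lt; exact.
apply: filterS near_a => r; set b := Num.max r 0.
have b0 : 0 <= b by rewrite le_max lexx orbT.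
rewrite lt_min => /andP[abd ab1].
have [ab|/ltW ba] := leP a b.
  rewrite rnorm_distC; apply: key => //; first lra.
  by move: abd; rewrite ler0_norm ?subr_le0// opprB.
by apply: key => //; [lra|move: abd; rewrite ger0_norm ?subr_ge0].
Qed.

Section Generator.
Context {A : unbounded_operator X}.
Hypothesis genT : forall x y, (dom A x /\ A x = y) <->
  (h^-1)%:C%C *: (T h x - x) @[h --> 0^'+] --> y.

(** The difference quotient of T(t) p is T(t) applied to that of p. *)
Lemma generator_commutes t p : 0 <= t -> dom A p ->
  dom A (T t p) /\ A (T t p) = T t (A p).
Proof.
move=> t0 dp; apply/genT.
have /genT hp : dom A p /\ A p = A p by [].
have cT : continuous (T t) by case: (bT t0).
have := cvg_comp _ _ hp (cT (A p)); apply: cvg_trans; apply: near_eq_cvg.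
near=> h; have h0 : 0 <= h by apply/ltW; near: h; exact: nbhs_right_gt.
rewrite /= (linear_funZ _ _ (lT t0)) (linear_funB _ _ (lT t0)).
by rewrite -!TD// (addrC h).
Unshelve. all: by end_near. Qed.

(** Only the right derivative at 0 is given. Both one-sided quotients at t have the
    form T(s) q(k) with k = |h|, q(k) the quotient at 0 and s the smaller time, so
    they converge by the exponential bound and the continuity of the orbit of A p. *)
Lemma semigroup_is_derive (t : R) p (y : X) : 0 < t -> dom A p ->
  is_derive t (1 : R) (fun t : R => rdot (extend_semigroup t p) y)
                (rdot (extend_semigroup t (A p)) y).
Proof.
move=> t0 dp.
have hder : (fun h : R => (h^-1)%:C%C *: (extend_semigroup (h + t) p - extend_semigroup t p)) @ 0^'
    --> extend_semigroup t (A p).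
  have [M [w [M0 w0 hT]]] := semigroup_exp_bound.
  pose C := M * expR (w * t); have C0 : 0 < C by rewrite mulr_gt0// expR_gt0.
  apply/cvg_rnormP => e e0.
  have /genT/cvg_rnormP hp : dom A p /\ A p = A p by [].
  have [|d /= d0 hd] := hp (e / (2 * C)); first by rewrite divr_gt0// mulr_gt0.
  have /cvg_rnormP hc := @semigroup_continuous (A p) t.
  have [|d' /= d'0 hd'] := hc (e / 2); first by rewrite divr_gt0.
  exists (Num.min (Num.min d d') t) => /=; first by rewrite !lt_min d0 d'0.
  move=> h /=; rewrite sub0r normrN !lt_min -andbA => /and3P[hhd hhd' hht] hn0.
  have hp0 : 0 < `|h| by rewrite normr_gt0.
  pose s := Num.min t (h + t).
  have s0 : 0 <= s.
    by rewrite le_min ltW//=; move: hht; rewrite ltr_norml => /andP[? _]; lra.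
  have st : s <= t by rewrite ge_min lexx.
  have ht0 : 0 <= h + t by rewrite (le_trans s0)// ge_min lexx orbT.
  have -> : (h^-1)%:C%C *: (extend_semigroup (h + t) p - extend_semigroup t p) =
      T s ((`|h|^-1)%:C%C *: (T `|h| p - p)).
    rewrite (linear_funZ _ _ (lT s0)) (linear_funB _ _ (lT s0)) -TD// /extend_semigroup !max_l ?(ltW t0)// /s.
    case: (ltrgt0P h) hn0 => [h0|h0|->]; rewrite ?eqxx// => _.
      by rewrite min_l ?lerDr ?(ltW h0)// (addrC t).
    rewrite min_r; last by rewrite gerDr ltW.
    by rewrite (addrC h t) addrK invrN rmorphN scaleNr -scalerN opprB.
  have hq : rnorm (A p - (`|h|^-1)%:C%C *: (T `|h| p - p)) < e / (2 * C).
    by apply: hd => //=; rewrite sub0r normrN normr_id.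
  have hs : rnorm (extend_semigroup t (A p) - extend_semigroup s (A p)) < e / 2.
    apply: hd' => /=; rewrite /s; case: (leP t (h + t)) => _; first by rewrite subrr normr0.
    by rewrite opprD addrCA subrr addr0 normrN.
  rewrite -(subrKA (T s (A p))) -(linear_funB _ _ (lT s0)).
  rewrite (le_lt_trans (rnormD _ _))//.
  move: hs; rewrite {2}/extend_semigroup max_l// => hs.
  have : rnorm (T s (A p - (`|h|^-1)%:C%C *: (T `|h| p - p))) < e / 2.
    rewrite (le_lt_trans (hT _ _ s0))//.
    rewrite (@le_lt_trans _ _ (C * rnorm (A p - (`|h|^-1)%:C%C *: (T `|h| p - p))))//.
      by rewrite ler_wpM2r ?rnorm_ge0// ler_pM2l// ler_expR ler_pM2l.
    by move: hq; rewrite invfM mulrA ltr_pdivlMr// mulrC.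
  lra.
have hr : (fun h : R => h^-1 *: (((fun t => rdot (extend_semigroup t p) y) \o shift t) (h *: 1)
    - rdot (extend_semigroup t p) y)) @ 0^' --> rdot (extend_semigroup t (A p)) y.
  rewrite (_ : (fun h : R => _) = (fun h : R => rdot ((h^-1)%:C%C *:
    (extend_semigroup (h + t) p - extend_semigroup t p)) y)); first exact: cvg_rdotl.
  by apply/funext => h; rewrite rdotZl rdotBl /= /GRing.scale/= mulr1.
apply: DeriveDef; first by apply/cvg_ex; exists (rdot (extend_semigroup t (A p)) y).
exact: cvg_lim hr.
Qed.
End Generator.
End Semigroup.


(** * Weak integrals of continuous functions *)

Section WeakIntegration.
Context {R : realType}.
Local Notation mu := (@lebesgue_measure R).
Implicit Types V : hilbertType R.

Lemma continuous_rnorm V (f : R -> V) : continuous f -> continuous (fun t => rnorm (f t)).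
Proof. by move=> cf t; apply: cvg_rnorm; exact: cf. Qed.

Lemma continuous_rdot V (f : R -> V) y : continuous f -> continuous (fun t => rdot (f t) y).
Proof. by move=> cf t; apply: cvg_rdotl; exact: cf. Qed.

(** Compose f with simple functions that approximate the identity of [0, +oo[. *)
Lemma continuous_strongly_measurable V (f : R -> V) (D : set R) :
  D `<=` `[0, +oo[ -> continuous f -> strongly_measurable D f.
Proof.
move=> D0 cf.
have mN : measurable (`[0, +oo[ : set R) by [].
have mE := @EFin_measurable R `[0, +oo[.
pose q := nnsfun_approx mN mE.
exists (fun n t => f (q n t)).
  move=> n; split.
    have -> : range (fun t => f (q n t)) = f @` range (q n).
      by rewrite -image_comp.
    by apply: finite_image; exact: fimfunP.
  move=> v.
  have -> : (fun t => f (q n t)) @^-1` [set v] = q n @^-1` (f @^-1` [set v]) by [].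
  rewrite -[X in measurable X]setTI; apply: measurable_funP => //.
  apply: closed_measurable; apply: closed_comp.
    by move=> t _; exact: cf.
  exact: accessible_closed_set1 (hausdorff_accessible (@norm_hausdorff _ V)) v.
apply: aeW => t /D0 t0; apply: continuous_cvg; first exact: cf.
have q0 (x : R) : `[0, +oo[%classic x -> (0 <= x%:E)%E.
  by rewrite /= in_itv/= andbT lee_fin.
have /fine_cvgP[_ h] := cvg_nnsfun_approx mN mE q0 t0.
exact: h.
Qed.

Lemma continuous_expN : continuous (fun t : R => expR (- t)).
Proof.
move=> t; apply: (@continuous_comp _ _ _ (fun t : R => - t) expR).
  exact: opp_continuous.
exact: continuous_expR.
Qed.

Lemma is_derive_NexpN (t : R) : is_derive t (1 : R) (fun t : R => - expR (- t)) (expR (- t)).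
Proof. by apply: is_derive_eq; rewrite mulrN1 opprK. Qed.

Lemma integral_exp_decay : (\int[mu]_(t in `[0%R, +oo[) (expR (- t))%:E = 1%:E)%E.
Proof.
have cE := continuous_expN.
rewrite (@ge0_continuous_FTC2y _ (fun t : R => expR (- t)) (fun t : R => - expR (- t)) 0 0).
- by rewrite oppr0 expR0 -EFinB sub0r opprK.
- by move=> x _; exact: expR_ge0.
- exact: continuous_subspaceT.
- by rewrite -[X in _ --> X]oppr0; apply: cvgN; exact: cvgr_expR.
- by move=> x _; have [] := is_derive_NexpN x.
- by apply: cvgN; apply: cvg_at_right_filter; exact: cE.
- by move=> x _; rewrite derive1E; have [_ ->] := is_derive_NexpN x.
Qed.

Lemma exp_decay_integral_lty (g : R -> R) (C : R) : continuous g ->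
  (forall t, 0 <= t -> 0 <= g t <= C * expR (- t)) ->
  (\int[mu]_(t in `[0%R, +oo[) (g t)%:E < +oo)%E.
Proof.
move=> cg gC.
have mg D : measurable_fun D (EFin \o g).
  by apply/measurable_EFinP; apply: measurable_funTS; exact: continuous_measurable_fun.
have cE := continuous_expN.
have C0 : 0 <= C.
  by have /andP[h1 h2] := gC 0 (lexx _); move: (le_trans h1 h2); rewrite oppr0 expR0 mulr1.
apply: (@le_lt_trans _ _ (\int[mu]_(t in `[0%R, +oo[) (C%:E * (expR (- t))%:E))%E).
  apply: ge0_le_integral => //=.
  - by move=> t; rewrite in_itv/= andbT => t0; rewrite lee_fin; case/andP: (gC t t0).
  - exact: mg.
  - apply/measurable_EFinP; apply: measurable_funM => //.
    by apply: measurable_funTS; exact: continuous_measurable_fun.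
  - by move=> t; rewrite in_itv/= andbT => t0; rewrite -EFinM lee_fin; case/andP: (gC t t0).
rewrite ge0_integralZl//=.
- by rewrite integral_exp_decay -EFinM ltry.
- apply/measurable_EFinP; apply: measurable_funTS; exact: continuous_measurable_fun.
Qed.

(** The fundamental theorem of calculus on a half-line for functions of any sign:
    adding C e^-t to g makes it nonnegative, and that correction integrates
    explicitly. *)
Lemma Rintegral_exp_decay (g G : R -> R) (C : R) :
  continuous g -> continuous G ->
  (forall t : R, 0 < t -> is_derive t (1 : R) G (g t)) ->
  (forall t, 0 <= t -> `|g t| <= C * expR (- t)) ->
  (forall t, 0 <= t -> `|G t| <= C * expR (- t)) ->
  Rintegral mu `[0, +oo[ g = - G 0.
Proof.
move=> cg cG dG gC GC.
have cE := continuous_expN.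
(* The derivative of - k is k, so G1 is a primitive of the nonnegative g1. *)
pose k t : R := C * expR (- t); pose g1 t := g t + k t; pose G1 t := G t - k t.
have mD : measurable (`[0, +oo[ : set R) by [].
have C0 : 0 <= C.
  have := gC 0 (lexx _); rewrite oppr0 expR0 mulr1; exact: le_trans.
have k0 t : 0 <= k t by rewrite mulr_ge0// expR_ge0.
have ck : continuous k by move=> t; apply: cvgM; [exact: cvg_cst | exact: cE].
have cg1 : continuous g1 by move=> t; apply: cvgD; [exact: cg | exact: ck].
have cG1 : continuous G1 by move=> t; apply: cvgB; [exact: cG | exact: ck].
have k_lim : k t @[t --> +oo] --> 0.
  rewrite -(mulr0 C); apply: cvgM; [exact: cvg_cst | exact: cvgr_expR].
have G_lim : G t @[t --> +oo] --> 0.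
  apply/cvgr0Pnorm_lt => e e0; move/cvgr0Pnorm_lt : k_lim => /(_ e e0).
  apply: filterS2 (nbhs_pinfty_ge (num_real 0)) => t t0.
  by apply: le_lt_trans; rewrite (le_trans (GC t t0))// ler_norm.
have dk (t : R) : is_derive t (1 : R) k (- k t).
  have -> : k = (fun t => (- C) * (- expR (- t))) by apply/funext => r; rewrite /k mulrNN.
  have h := is_derive_NexpN t.
  by apply: is_derive_eq; rewrite /GRing.scale/= mulrN mulNr opprK.
have dG1 (t : R) : 0 < t -> is_derive t (1 : R) G1 (g1 t).
  by move=> /dG h; apply: is_derive_eq; rewrite opprK.
have ge0 (f : R -> R) : continuous f -> (exists C', forall t, 0 <= t -> 0 <= f t <= C' * expR (- t)) ->
    mu.-integrable `[0, +oo[ (EFin \o f).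
  move=> cf [C' fC]; apply/integrableP; split.
    by apply/measurable_EFinP; apply: measurable_funTS; exact: continuous_measurable_fun.
  apply: le_lt_trans (exp_decay_integral_lty cf fC).
  rewrite le_eqVlt; apply/orP; left; apply/eqP; apply: eq_integral => t.
  rewrite inE/= in_itv/= andbT => t0; rewrite ger0_norm//.
  by case/andP: (fC t t0).
have g1C t : 0 <= t -> 0 <= g1 t <= (2 * C) * expR (- t).
  move=> t0; have := gC t t0; rewrite ler_norml -/(k t) /g1 -mulrA => /andP[? ?].
  by rewrite -/(k t); apply/andP; split; lra.
have -> : g = (fun t => g1 t - k t) by apply/funext => t; rewrite /g1 addrK.
rewrite RintegralB//; last 2 first.
- by apply: ge0 => //; exists (2 * C).
- by apply: ge0 => //; exists C => t t0; rewrite k0 lexx.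
rewrite (@Rintegral_ge0_continuous_FTC2y _ g1 G1 0 0).
- rewrite (@Rintegral_ge0_continuous_FTC2y _ k (fun t => - k t) 0 0).
  + rewrite /G1; lra.
  + by [].
  + exact: continuous_subspaceT.
  + by rewrite -[X in _ --> X]oppr0; apply: cvgN.
  + by move=> t _; apply: derivableN; have [] := dk t.
  + by apply: cvgN; apply: cvg_at_right_filter; exact: ck.
  + by move=> t _; rewrite derive1E; have [d ->] := is_deriveN (dk t); rewrite opprK.
- by move=> t t0; case/andP: (g1C t t0).
- exact: continuous_subspaceT.
- rewrite [X in _ --> X](_ : 0 = 0 - 0 :> R); last by rewrite subr0.
  exact: cvgB.
- by move=> t /dG1[].
- by apply: cvg_at_right_filter; exact: cG1.
- move=> t; rewrite in_itv/= andbT => t0; rewrite derive1E; by have [_ ->] := dG1 t t0.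
Qed.

(** A continuous function that is weakly the derivative of F has integral
    F(t) - F(0): the value of a Bochner integral is tested by inner products, where
    the scalar fundamental theorem applies. This replaces any construction of
    vector-valued integrals. *)
Lemma bochner_integral_derivative V (f F : R -> V) :
  continuous f -> continuous F ->
  (forall (t : R) (y : V), 0 < t -> is_derive t (1 : R) (fun t => rdot (F t) y)
    (rdot (f t) y)) ->
  forall t, 0 <= t -> bochner_integral `[0, t] f (F t - F 0).
Proof.
move=> cf cF dF t t0.
have sub : `[0, t] `<=` (`[0, +oo[ : set R).
  by move=> r /=; rewrite !in_itv/= andbT => /andP[].
have FTC y : rdot (F t - F 0) y = Rintegral mu `[0, t] (fun r => rdot (f r) y).
  move: t0; rewrite le_eqVlt => /predU1P[<-|t0].
    by rewrite subrr rdot0l set_itv1 Rintegral_set1.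
  rewrite /Rintegral (@continuous_FTC2 _ _ (fun t => rdot (F t) y))//.
  - by rewrite rdotBl.
  - by apply: continuous_subspaceT; exact: continuous_rdot.
  - have cFy : continuous (fun t => rdot (F t) y) by exact: continuous_rdot.
    split.
    + by move=> r; rewrite in_itv/= => /andP[r0 _]; have [] := dF r y r0.
    + by apply: cvg_at_right_filter; exact: cFy.
    + by apply: cvg_at_left_filter; exact: cFy.
  - by move=> r; rewrite in_itv/= => /andP[r0 _]; rewrite derive1E; have [_ ->] := dF r y r0.
split; last first.
  move=> w; rewrite innerE /complex_integral; congr Complex; rewrite FTC.
    by [].
  by apply: eq_Rintegral => r _; rewrite innerE.
split; first exact: continuous_strongly_measurable.
have /integrableP[_] : mu.-integrable `[0, t] (EFin \o (fun r => rnorm (f r))).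
  apply: continuous_compact_integrable; first exact: segment_compact.
  by apply: continuous_subspaceT; exact: continuous_rnorm.
apply: le_lt_trans; rewrite le_eqVlt; apply/orP; left; apply/eqP.
by apply: eq_integral => r _ /=; rewrite ger0_norm// rnorm_ge0.
Qed.
End WeakIntegration.


(** * The transfer function is B* (s - A)^-1 B *)

Section Adjoint.
Context {R : realType} {X U : hilbertType R} {B : U -> X} {Bs : X -> U}.
Hypothesis adjB : adjoint_of B Bs.

Lemma rdot_adjoint v w : rdot (B v) w = rdot v (Bs w).
Proof. by rewrite /rdot adjB. Qed.

Lemma adjoint_bounded : bounded_operator B -> bounded_operator Bs.
Proof.
move=> /bounded_operatorP[lB [m m0 hm]]; apply/bounded_operatorP; split.
  move=> a x y; have inner_ext (p q : U) : (forall w, inner w p = inner w q) -> p = q.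
    by move=> h; apply: rdot_ext => w; rewrite ![rdot _ w]rdotC /rdot h.
  apply: inner_ext => w.
  by rewrite -adjB !(innerDr, innerZr) !adjB.
exists m => // x; have [z|n0] := eqVneq (rnorm (Bs x)) 0.
  by rewrite z mulr_ge0 ?rnorm_ge0 ?ltW.
have p0 : 0 < rnorm (Bs x) by rewrite lt_neqAle eq_sym n0 rnorm_ge0.
rewrite -(ler_pM2l p0) -expr2 rnorm_sqr -rdot_adjoint.
rewrite (le_trans (ler_norm _))// (le_trans (rdot_le _ _))//.
by rewrite mulrCA mulrA ler_wpM2r ?rnorm_ge0.
Qed.
End Adjoint.

Section ResolventIdentity.
Context {R : realType} {X : hilbertType R} {A : unbounded_operator X}.

Lemma resolvent_identity s b x : resolvent_set A s -> resolvent_set A b ->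
  resolvent A s x - resolvent A b x = - ((s - b) *: resolvent A s (resolvent A b x)).
Proof.
move=> /resolvent_ofP[[lS _] S1 S2] /resolvent_ofP[_ T1 _].
have [d e] := T1 x; set r := resolvent A b x in d e *.
rewrite -[X in _ - X](S2 _ d) -(linear_funB _ _ lS) -{1}e.
rewrite (_ : b *: r - A r - _ = - ((s - b) *: r)).
  by rewrite (linear_funN _ lS) (linear_funZ _ _ lS).
by rewrite scalerBl !opprB addrA subrK.
Qed.
End ResolventIdentity.

Section TransferFunction.
Context {R : realType}.
Local Notation mu := (@lebesgue_measure R).

Lemma expc_real (s t : R) : expc (- (s%:C%C * t%:C%C)) = (expR (- s * t))%:C%C.
Proof.
rewrite -rmorphM -rmorphN /expc /= cos0 sin0 mulr1 mulr0 mulNr; congr Complex.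
Qed.

(** At a real point the weight e^(-st) is real, so real parts can be taken. *)
Lemma laplace_real (V : hilbertType R) (f : R -> V) (s : R) v y :
  laplace f s%:C%C v ->
  rdot v y = Rintegral mu `[0, +oo[ (fun t => expR (- s * t) * rdot (f t) y).
Proof.
move=> [_ /(_ y)]; rewrite /complex_integral {1}/rdot => ->/=.
by apply: eq_Rintegral => t _; rewrite expc_real -rdotZl.
Qed.

(** The input 2 e^(-2t) - e^(-t) is chosen with integral zero over [0, +oo[:
    this makes the coefficient of T(t) in the resulting trajectory lie in the range
    of A, so that the trajectory has an explicit primitive even when 0 belongs to
    the spectrum of A. *)
Definition test_scalar (t : R) : R := 2 * expR (- 2 * t) - expR (- 1 * t).
(** The solution h of s h - h' = [test_scalar]; thus - e^(-st) h is a primitive of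
    e^(-st) times the input, and h(0) is the Laplace transform of the input at s. *)
Definition test_primitive (s t : R) : R :=
  2 / (s + 2) * expR (- 2 * t) - (s + 1)^-1 * expR (- 1 * t).

Lemma continuous_expM (a : R) : continuous (fun t : R => expR (a * t)).
Proof.
move=> t; apply: (@continuous_comp _ _ _ (fun t : R => a * t) expR).
  by apply: cvgM; [exact: cvg_cst|exact: cvg_id].
exact: continuous_expR.
Qed.

Lemma continuous_test_scalar : continuous test_scalar.
Proof.
move=> t; apply: cvgB; last exact: continuous_expM.
by apply: cvgM; [exact: cvg_cst|exact: continuous_expM].
Qed.

Lemma continuous_test_primitive s : continuous (test_primitive s).
Proof.
by move=> t; apply: cvgB; (apply: cvgM; [exact: cvg_cst|exact: continuous_expM]).
Qed.

Lemma test_scalar_le (t : R) : 0 <= t -> `|test_scalar t| <= 3 * expR (- t).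
Proof.
move=> t0; rewrite /test_scalar.
have e1 : expR (- 1 * t) = expR (- t) by rewrite mulN1r.
have e2 : expR (- 2 * t) <= expR (- t) by rewrite ler_expR; lra.
have e0 := expR_ge0 (- 2 * t); have e0' := expR_ge0 (- t).
by rewrite e1 ler_norml; apply/andP; split; lra.
Qed.

Lemma test_primitive_le (s t : R) : 0 < s -> 0 <= t -> `|test_primitive s t| <= 3.
Proof.
move=> s0 t0; rewrite /test_primitive.
have e1 : expR (- 1 * t) <= 1 by rewrite -[leRHS]expR0 ler_expR; lra.
have e2 : expR (- 2 * t) <= 1 by rewrite -[leRHS]expR0 ler_expR; lra.
have e0 := expR_ge0 (- 2 * t); have e0' := expR_ge0 (- 1 * t).
have i1 : 0 <= (s + 1)^-1 <= 1.
  have s1 : 0 < s + 1 by lra.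
  by rewrite invr_ge0 invf_le1// ltW//= lerDr ltW.
have i2 : 0 <= 2 / (s + 2) <= 1.
  have s2 : 0 < s + 2 by lra.
  by apply/andP; split; [apply: divr_ge0; lra | rewrite ler_pdivrMr//; lra].
move: (2 / (s + 2)) i2 => k /andP[? ?]; have /andP[? ?] := i1.
have h1 : 0 <= (s + 1)^-1 * expR (- 1 * t) <= 1 by rewrite mulr_ge0 ?mulr_ile1.
have h2 : 0 <= k * expR (- 2 * t) <= 1 by rewrite mulr_ge0 ?mulr_ile1.
by rewrite ler_norml; apply/andP; split; lra.
Qed.

Lemma is_derive_test_primitive (s c t : R) : 0 < s ->
  is_derive t (1 : R) (fun t : R => - (expR (- s * t) * (test_primitive s t * c)))
    (expR (- s * t) * (test_scalar t * c)).
Proof.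
move=> s0; rewrite /test_primitive.
apply: is_derive_eq; rewrite /GRing.scale/= /test_scalar; field.
by apply/andP; split; lra.
Qed.

Lemma Rintegral_test_input (s c : R) : 1 <= s ->
  Rintegral mu `[0, +oo[ (fun t => expR (- s * t) * (test_scalar t * c))
  = test_primitive s 0 * c.
Proof.
move=> s1; have s0 : 0 < s by lra.
have E1 (t : R) : 0 <= t -> 0 <= expR (- s * t) <= expR (- t).
  by move=> t0; rewrite expR_ge0 ler_expR; nra.
have cE := @continuous_expM (- s).
pose G (t : R) := - (expR (- s * t) * (test_primitive s t * c)).
have -> : test_primitive s 0 * c = - G 0 by rewrite /G mulr0 expR0 mul1r opprK.
apply: (@Rintegral_exp_decay _ _ G (3 * `|c|)).
- move=> t; apply: cvgM; first exact: cE.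
  by apply: cvgM; [exact: continuous_test_scalar | exact: cvg_cst].
- move=> t; apply: cvgN; apply: cvgM; first exact: cE.
  by apply: cvgM; [exact: continuous_test_primitive | exact: cvg_cst].
- by move=> t _; exact: is_derive_test_primitive.
- move=> t t0; have /andP[h0 h1] := E1 _ t0; rewrite !normrM ger0_norm// mulrC.
  have := test_scalar_le t0; have : expR (- t) <= 1 by rewrite -[leRHS]expR0 ler_expR; lra.
  by move=> h2 h3; apply: ler_pM => //; rewrite ?mulr_ge0 ?ler_wpM2r//; lra.
- move=> t t0; have /andP[h0 h1] := E1 _ t0; rewrite normrN !normrM ger0_norm// mulrC.
  have h := test_primitive_le s0 t0.
  by apply: ler_pM => //; rewrite ?mulr_ge0 ?ler_wpM2r.
Qed.

Section TestTrajectory.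
Context {X U : hilbertType R} {A : unbounded_operator X} {T : R -> X -> X}.
Context {B : U -> X} {Bs : X -> U}.
Hypotheses (skewA : skew_adjoint A) (genT : generates A T).
Hypotheses (bddB : bounded_operator B) (adjB : adjoint_of B Bs).

Let m1 : (-1 : R) != 0. Proof. by rewrite oppr_eq0 oner_eq0. Qed.
Let m2 : (-2 : R) != 0. Proof. by rewrite oppr_eq0 pnatr_eq0. Qed.
Let C0T : C0_semigroup T. Proof. by case: genT. Qed.
Let genA := let: conj _ h := genT in h.
Local Notation S := (@extend_semigroup R X T).

Variable (v : U).
Let b := B v.
Let r1 := resolvent A (-1)%:C%C b.
Let r2 := resolvent A (-2)%:C%C b.
Let p := r1 - r2.

Let r1P : dom A r1 /\ A r1 = - r1 - b.
Proof.
have [_ /(_ b)[d e] _] := resolvent_ofP (skew_resolvent skewA m1).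
by split => //; rewrite -[X in _ - X]e -/r1 rmorphN1 scaleN1r opprB opprK addrC addrK.
Qed.
Let r2P : dom A r2 /\ A r2 = (- 2)%:C%C *: r2 - b.
Proof.
have [_ /(_ b)[d e] _] := resolvent_ofP (skew_resolvent skewA m2).
by split => //; rewrite -[X in _ - X]e subKr.
Qed.
Let pP : dom A p. Proof. by apply: domB; [case: r1P|case: r2P]. Qed.
Let ApE : A p = 2%:C%C *: r2 - r1.
Proof.
have [d1 e1] := r1P; have [d2 e2] := r2P.
by rewrite opB// e1 e2 rmorphN scaleNr opprD !opprK addrA addrAC subrK addrC.
Qed.
Let ApP : dom A (A p).
Proof. by rewrite ApE; apply: domB; [apply: domZ; case: r2P|case: r1P]. Qed.

Definition test_input (t : R) : U := (test_scalar t)%:C%C *: v.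
(** The solution of z' = A z + (2 e^(-2t) - e^(-t)) b with z(0) = 0; the last
    term is the orbit that corrects the initial value of the first two. *)
Definition test_state (t : R) : X :=
  (2 * expR (- 2 * t))%:C%C *: r2 - (expR (- 1 * t))%:C%C *: r1 - S t (A p).
(** This is the integral of [test_state] from 0 because e^(-t) r1, e^(-2t) r2
    and T(t) p are primitives of the three terms and cancel at 0. *)
Definition test_state_primitive (t : R) : X :=
  (expR (- 1 * t))%:C%C *: r1 - (expR (- 2 * t))%:C%C *: r2 - S t p.
Definition test_force_primitive (t : R) : X :=
  (expR (- 1 * t) - expR (- 2 * t))%:C%C *: b.

Lemma continuous_realZ (V : hilbertType R) (f : R -> R) (x : V) :
  continuous f -> continuous (fun t => (f t)%:C%C *: x).
Proof.
move=> cf t; apply/cvg_rnormP => e e0.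
have x1 : 0 < rnorm x + 1 by rewrite ltr_wpDl ?rnorm_ge0.
have /cvgrPdist_lt /(_ (e / (rnorm x + 1)))h := cf t.
have {}/h : 0 < e / (rnorm x + 1) by rewrite divr_gt0.
apply: filterS => r; rewrite ltr_pdivlMr// -scalerBl -rmorphB rnormZ.
by apply: le_lt_trans; rewrite ler_wpM2l// lerDl.
Qed.

Lemma continuous_test_input : continuous test_input.
Proof. exact: continuous_realZ continuous_test_scalar. Qed.

Lemma continuous_test_state : continuous test_state.
Proof.
have c2 : continuous (fun t : R => 2 * expR (- 2 * t)).
  by move=> r; apply: cvgM; [exact: cvg_cst|exact: continuous_expM].
have h2 := continuous_realZ (x := r2) c2.
have h1 := continuous_realZ (x := r1) (@continuous_expM (- 1)).
move=> t; apply: cvgB; last exact: (semigroup_continuous C0T).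
by apply: cvgB; [exact: h2|exact: h1].
Qed.

Lemma continuous_test_state_primitive : continuous test_state_primitive.
Proof.
have h2 := continuous_realZ (x := r2) (@continuous_expM (- 2)).
have h1 := continuous_realZ (x := r1) (@continuous_expM (- 1)).
move=> t; apply: cvgB; last exact: (semigroup_continuous C0T).
by apply: cvgB; [exact: h1|exact: h2].
Qed.

Lemma test_state0 : test_state 0 = 0.
Proof.
have [_ T0 _ _] := C0T.
rewrite /test_state !mulr0 expR0 mulr1 scale1r /extend_semigroup maxxx T0 ApE.
by rewrite subrr.
Qed.

Lemma test_state_primitive0 : test_state_primitive 0 = 0.
Proof.
have [_ T0 _ _] := C0T.
rewrite /test_state_primitive !mulr0 expR0 !scale1r /extend_semigroup maxxx T0.
by rewrite subrr.
Qed.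

Lemma is_derive_test_state_primitive (t : R) (y : X) : 0 < t ->
  is_derive t (1 : R) (fun t : R => rdot (test_state_primitive t) y)
    (rdot (test_state t) y).
Proof.
move=> t0; have h := semigroup_is_derive C0T genA y t0 pP.
rewrite (_ : (fun t : R => _) = (fun t : R =>
  expR (- 1 * t) * rdot r1 y - expR (- 2 * t) * rdot r2 y - rdot (S t p) y)); last first.
  by apply/funext => r; rewrite !rdotBl !rdotZl.
by apply: is_derive_eq; rewrite /GRing.scale/= !rdotBl !rdotZl; ring.
Qed.

(** The weak form of z' = A z + (2 e^(-2t) - e^(-t)) b, with A moved to the test
    vector y by skewness. *)
Lemma is_derive_test_state (t : R) (y : X) : 0 < t -> dom A y ->
  is_derive t (1 : R) (fun t : R => rdot (test_state t) y)
    (test_scalar t * rdot b y - rdot (test_state t) (A y)).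
Proof.
move=> t0 dy; have h := semigroup_is_derive C0T genA y t0 ApP.
rewrite (_ : (fun t : R => _) = (fun t : R =>
  2 * expR (- 2 * t) * rdot r2 y - expR (- 1 * t) * rdot r1 y - rdot (S t (A p)) y)); last first.
  by apply/funext => r; rewrite !rdotBl !rdotZl.
have m0 : 0 <= Num.max t 0 by rewrite le_max lexx orbT.
have [dS eS] := generator_commutes C0T genA m0 ApP.
have [d1 e1] := r1P; have [d2 e2] := r2P.
apply: is_derive_eq; rewrite /GRing.scale/= !rdotBl !rdotZl /test_scalar.
rewrite /extend_semigroup -eS (skew_rdot skewA dS dy).
have -> : rdot r1 (A y) = rdot r1 y + rdot b y.
  by have := skew_rdot skewA d1 dy; rewrite e1 rdotBl rdotNl; lra.
have -> : rdot r2 (A y) = 2 * rdot r2 y + rdot b y.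
  by have := skew_rdot skewA d2 dy; rewrite e2 rdotBl rdotZl; lra.
ring.
Qed.

Lemma test_state_solution : solution A B 0 test_input test_state.
Proof.
split; first by apply: continuous_subspaceT; exact: continuous_test_state.
move=> t t0; exists (test_state_primitive t), (test_force_primitive t).
have m0 : 0 <= Num.max t 0 by rewrite le_max lexx orbT.
have [dS eS] := generator_commutes C0T genA m0 pP.
have [d1 e1] := r1P; have [d2 e2] := r2P.
have [lB _] := bddB.
split.
- rewrite -[test_state_primitive t]subr0 -test_state_primitive0.
  apply: bochner_integral_derivative => //.
  + exact: continuous_test_state.
  + exact: continuous_test_state_primitive.
  + by move=> r y r0; exact: is_derive_test_state_primitive.
- by apply: domB dS; apply: domB; exact: domZ.
- have F0 : test_force_primitive 0 = 0.
    by rewrite /test_force_primitive !mulr0 subrr scale0r.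
  rewrite -[test_force_primitive t]subr0 -F0.
  have -> : (fun r => B (test_input r)) = (fun r => (test_scalar r)%:C%C *: b).
    by apply/funext => r; rewrite /test_input (linear_funZ _ _ lB).
  apply: bochner_integral_derivative => //.
  + exact: continuous_realZ continuous_test_scalar.
  + apply: continuous_realZ => r.
    by apply: cvgB; exact: continuous_expM.
  + move=> r y r0; rewrite (_ : (fun t : R => _) = (fun t : R =>
      (expR (- 1 * t) - expR (- 2 * t)) * rdot b y)); last first.
      by apply/funext => x; rewrite rdotZl.
    apply: is_derive_eq; rewrite /GRing.scale/= rdotZl /test_scalar; ring.
- rewrite add0r /test_state_primitive opB//; last by apply: domB; exact: domZ.
  rewrite opB ?opZ//; try exact: domZ.
  rewrite eS e1 e2; apply: rdot_ext => y.
  rewrite !(rdotDl, rdotBl, rdotNl, rdotZl); ring.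
Qed.

Lemma test_input_square_integrable : square_integrable `[0, +oo[ test_input.
Proof.
have cu := continuous_test_input.
split; first exact: continuous_strongly_measurable.
apply: (@exp_decay_integral_lty _ (fun t => rnorm (test_input t) ^+ 2) (9 * rnorm v ^+ 2)).
  move=> t; apply: (@continuous_comp _ _ _ (fun t => rnorm (test_input t)) (fun x => x ^+ 2)).
    exact: continuous_rnorm.
  exact: exprn_continuous.
move=> t t0; rewrite sqr_ge0/= /test_input rnormZ exprMn [leRHS]mulrAC ler_wpM2r ?sqr_ge0//.
have h := test_scalar_le t0.
have h1 : expR (- t) <= 1 by rewrite -[leRHS]expR0 ler_expR; lra.
have h0 := expR_ge0 (- t); have hn := normr_ge0 (test_scalar t).
by rewrite (@le_trans _ _ ((3 * expR (- t)) ^+ 2))//; [rewrite lerXn2r// nnegrE mulr_ge0|nra].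
Qed.

(** Ensures that e^(-st) z(t) decays once s is large. *)
Lemma test_state_exp_bound : exists C w : R, [/\ 0 < w, 0 <= C &
  forall t, 0 <= t -> rnorm (test_state t) <= C * expR (w * t)].
Proof.
have [M [w [M0 w0 hT]]] := semigroup_exp_bound C0T.
exists (2 * rnorm r2 + rnorm r1 + M * rnorm (A p)), w; split => //.
  by rewrite !addr_ge0// ?mulr_ge0// ?rnorm_ge0// ltW.
move=> t t0; rewrite /test_state.
have e1 : expR (- 1 * t) <= expR (w * t) by rewrite ler_expR; nra.
have e2 : expR (- 2 * t) <= expR (w * t) by rewrite ler_expR; nra.
rewrite (le_trans (rnormB _ _))// [leRHS]mulrDl; apply: lerD.
  rewrite (le_trans (rnormB _ _))// [leRHS]mulrDl; apply: lerD; rewrite rnormZ ger0_norm.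
  - by rewrite -!mulrA ler_pM2l// mulrC ler_wpM2l ?rnorm_ge0.
  - by rewrite mulr_ge0// expR_ge0.
  - by rewrite mulrC ler_wpM2l ?rnorm_ge0.
  - exact: expR_ge0.
by rewrite /extend_semigroup max_l// mulrAC; exact: hT.
Qed.

Lemma laplace_test_input (s : R) u : 1 <= s -> laplace test_input s%:C%C u ->
  u = (test_primitive s 0)%:C%C *: v.
Proof.
move=> s1 hu; apply: rdot_ext => y; rewrite (laplace_real y hu) rdotZl.
rewrite -(Rintegral_test_input _ s1); apply: eq_Rintegral => t _.
by rewrite rdotZl.
Qed.

(** With q = (s + A)^-1 B x, the derivative of e^(-st) (<z, q> + h <b, q>) is
    - e^(-st) <z, (s + A) q> = - e^(-st) <z, B x>, by the weak differential equation
    and the definition of h. Integrating gives h(0) <b, q>, which is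
    h(0) <(s - A)^-1 b, B x> as the adjoint of (s - A)^-1 is (s + A)^-1. *)
Lemma laplace_test_output : exists s0 : R, forall s y, s0 <= s ->
  laplace (fun t => Bs (test_state t)) s%:C%C y ->
  y = (test_primitive s 0)%:C%C *: Bs (resolvent A s%:C%C b).
Proof.
have [C [w [w0 C0 hz]]] := test_state_exp_bound.
exists (w + 1) => s y sw hy; apply: rdot_ext => x.
have s0 : 0 < s by lra.
have sn0 : s != 0 by rewrite gt_eqF.
have Nsn0 : - s != 0 by rewrite oppr_eq0.
rewrite (laplace_real x hy) rdotZl [rdot (Bs _) x]rdotC -(rdot_adjoint adjB) rdotC.
rewrite (skew_resolvent_adjoint skewA)// -rdotNr.
have [_ /(_ (B x))[dq eq] _] := resolvent_ofP (skew_resolvent skewA Nsn0).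
(* This is (s + A)^-1 B x. *)
pose q := - resolvent A (- s)%:C%C (B x).
have dq' : dom A q by exact: domN.
have eq' : s%:C%C *: q + A q = B x.
  by rewrite opN// scalerN -scaleNr -rmorphN.
rewrite -/q; pose G t := - (expR (- s * t) * (rdot (test_state t) q + test_primitive s t * rdot b q)).
have -> : test_primitive s 0 * rdot b q = - G 0.
  by rewrite /G test_state0 rdot0l mulr0 expR0 mul1r add0r opprK.
have E1 t : 0 <= t -> 0 <= expR (- s * t) <= expR (- t).
  by move=> t0; rewrite expR_ge0 ler_expR; nra.
have E2 (t : R) : 0 <= t -> expR (- s * t) * expR (w * t) <= expR (- t).
  by move=> t0; rewrite -expRD ler_expR; nra.
have hzb t x' : 0 <= t -> expR (- s * t) * `|rdot (test_state t) x'| <= C * rnorm x' * expR (- t).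
  move=> t0; rewrite mulrAC.
  have h1 : rnorm (test_state t) * rnorm x' <= C * expR (w * t) * rnorm x'.
    by rewrite ler_wpM2r ?rnorm_ge0// hz.
  rewrite (@le_trans _ _ (expR (- s * t) * (C * expR (w * t) * rnorm x')))//.
    by rewrite ler_wpM2l ?expR_ge0// (le_trans (rdot_le _ _)).
  rewrite mulrA ler_wpM2r ?rnorm_ge0// mulrCA ler_wpM2l// E2//.
have -> : Rintegral mu `[0, +oo[ (fun t => expR (- s * t) * rdot (Bs (test_state t)) x) =
    Rintegral mu `[0, +oo[ (fun t => expR (- s * t) * rdot (test_state t) (B x)).
  apply: eq_Rintegral => t _; congr (_ * _).
  by rewrite rdotC -(rdot_adjoint adjB) rdotC.
pose K := C * rnorm (B x) + C * rnorm q + 3 * `|rdot b q|.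
have K1 : 0 <= C * rnorm (B x) by rewrite mulr_ge0// rnorm_ge0.
have K2 : 0 <= C * rnorm q by rewrite mulr_ge0// rnorm_ge0.
have K3 : 0 <= 3 * `|rdot b q| by rewrite mulr_ge0.
apply: (@Rintegral_exp_decay _ _ G K).
- move=> t; apply: cvgM; first exact: continuous_expM.
  by apply: cvg_rdotl; exact: continuous_test_state.
- move=> t; apply: cvgN; apply: cvgM; first exact: continuous_expM.
  apply: cvgD; first by apply: cvg_rdotl; exact: continuous_test_state.
  by apply: cvgM; [exact: continuous_test_primitive | exact: cvg_cst].
- move=> t t0; have h1 := is_derive_test_state t0 dq'.
  rewrite (_ : G = (fun t => - (expR (- s * t) * rdot (test_state t) q) +
     - (expR (- s * t) * (test_primitive s t * rdot b q)))); last first.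
    by apply/funext => r; rewrite /G mulrDr opprD.
  apply: is_derive_eq; rewrite -eq' rdotDr rdotZr /GRing.scale/=.
  rewrite /test_scalar /test_primitive; field.
  by apply/andP; split; rewrite gt_eqF//; lra.
- move=> t t0; rewrite normrM (ger0_norm (expR_ge0 _)).
  by rewrite (le_trans (hzb _ _ t0))// ler_wpM2r ?expR_ge0// /K; lra.
- move=> t t0; rewrite normrN normrM (ger0_norm (expR_ge0 _)).
  have := ler_normD (rdot (test_state t) q) (test_primitive s t * rdot b q).
  move=> /(ler_wpM2l (expR_ge0 (- s * t)))/le_trans; apply.
  rewrite mulrDr (@le_trans _ _ (C * rnorm q * expR (- t) + 3 * `|rdot b q| * expR (- t)))//.
    apply: lerD; first exact: hzb.
    have /andP[h0 h1] := E1 _ t0.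
    rewrite mulrC normrM; apply: ler_pM => //; rewrite ?mulr_ge0//.
    by rewrite ler_wpM2r// test_primitive_le.
  by rewrite -mulrDl ler_wpM2r ?expR_ge0// /K; lra.
Qed.
End TestTrajectory.

(** The difference relation is the resolvent identity for B* (s - A)^-1 B, so it
    determines H up to a constant operator. That operator vanishes because at one
    large real point r the Laplace transforms of the test trajectory give
    h(0) H(r) v = h(0) B* (r - A)^-1 B v with h(0) = r / ((r + 1) (r + 2)). *)
Theorem transfer_function_resolvent (X U : hilbertType R)
    (A : unbounded_operator X) (T : R -> X -> X) (B : U -> X) (Bs : X -> U)
    (H : R[i] -> U -> U) :
  skew_adjoint A -> generates A T -> bounded_operator B -> adjoint_of B Bs ->
  transfer_function A B Bs H ->
  forall s, resolvent_set A s -> forall v, H s v = Bs (resolvent A s (B v)).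
Proof.
move=> skewA genT bddB adjB [Hb Hd Hl] s rs v.
have [lBs _] := adjoint_bounded adjB bddB.
have [a ha] := Hl _ _ (test_input_square_integrable v)
  (test_state_solution skewA genT bddB v).
have [s0 hs0] := laplace_test_output skewA genT adjB v.
pose r := Num.max (Num.max (a + 1) s0) 1.
have r1 : 1 <= r by rewrite le_max lexx orbT.
have r0 : r != 0 by rewrite gt_eqF// (lt_le_trans ltr01).
have rho_r : resolvent_set A r%:C%C by exact: skew_resolvent.
have [|u hu hy] := ha _ rho_r.
  by rewrite /= lt_max lt_max ltrDl ltr01.
have uE := laplace_test_input r1 hu.
have yE : H r%:C%C u = (test_primitive r 0)%:C%C *: Bs (resolvent A r%:C%C (B v)).
  by apply: hs0 hy; rewrite !le_max lexx orbT.
have [lHr _] := Hb _ rho_r.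
have Hr : H r%:C%C v = Bs (resolvent A r%:C%C (B v)).
  (* The Laplace transform of the scalar input at r is r / ((r + 1) (r + 2)). *)
  have c0 : (test_primitive r 0)%:C%C != 0 :> R[i].
    rewrite (inj_eq (@complexI R)) /test_primitive !mulr0 expR0 !mulr1.
    have -> : 2 / (r + 2) - (r + 1)^-1 = r / ((r + 2) * (r + 1)).
      by field; apply/andP; split; rewrite gt_eqF//; lra.
    by rewrite mulf_neq0// invr_eq0 mulf_neq0// gt_eqF//; lra.
  by apply: (scalerI c0); rewrite -yE uE (linear_funZ _ _ lHr).
have [->//|sr] := eqVneq s r%:C%C.
have sr0 : s - r%:C%C != 0 by rewrite subr_eq0.
have := Hd _ _ rs rho_r sr v.
move=> /(congr1 (fun x => (s - r%:C%C) *: x)); rewrite scalerA divff// scale1r.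
rewrite Hr scalerN -(linear_funZ _ _ lBs) => h.
apply: (@addIr _ (- Bs (resolvent A r%:C%C (B v)))).
by rewrite h -(linear_funN ((s - r%:C%C) *: _) lBs) -(resolvent_identity (B v) rs rho_r) (linear_funB _ _ lBs).
Qed.
End TransferFunction.


(** * The Grushin problem *)

Section BoundedOperators.
Context {R : realType}.
Implicit Types V W Y : hilbertType R.

Lemma bounded_operator_comp V W Y (f : W -> Y) (g : V -> W) :
  bounded_operator f -> bounded_operator g -> bounded_operator (f \o g).
Proof.
move=> [lf cf] [lg cg]; split; first by move=> a x y /=; rewrite lg lf.
by move=> x; apply: continuous_comp; [exact: cg | exact: cf].
Qed.

Lemma bounded_operatorB V W (f g : V -> W) :
  bounded_operator f -> bounded_operator g -> bounded_operator (fun x => f x - g x).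
Proof.
move=> [lf cf] [lg cg]; split.
  by move=> a x y; rewrite lf lg scalerBr opprD addrACA.
by move=> x; apply: cvgB; [exact: cf | exact: cg].
Qed.

Lemma bounded_operatorN V W (f : V -> W) :
  bounded_operator f -> bounded_operator (fun x => - f x).
Proof.
move=> [lf cf]; split; first by move=> a x y; rewrite lf opprD scalerN.
by move=> x; apply: cvgN; exact: cf.
Qed.

Lemma bounded_operator_id V : bounded_operator (@id V).
Proof. by split => [//|x]; exact: cvg_id. Qed.
End BoundedOperators.

Section GraphNorm.
Context {R : realType} {X : hilbertType R} {A : unbounded_operator X}.

(** Replacing the square root by a sum makes the bounds below linear. *)
Lemma graph_norm_le x : graph_norm A x <= (rnorm x + rnorm (A x))%:C%C.
Proof.
rewrite /graph_norm rmorphD/= -!rnormE.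
rewrite -[leRHS]sqrCK ?addr_ge0// ler_sqrtC ?nnegrE ?addr_ge0 ?exprn_ge0//.
by rewrite sqrrD addrAC lerDl mulrn_wge0// mulr_ge0.
Qed.

Lemma resolvent_graph_bounded s : resolvent_set A s ->
  exists2 m : R, 0 < m &
    forall x, graph_norm A (resolvent A s x) <= (m * rnorm x)%:C%C.
Proof.
move=> /resolvent_ofP[/bounded_operatorP[lR [m m0 hm]] RP _].
exists (m + `|complex.Re `|s| | * m + 1).
  by rewrite ltr_wpDl// addr_ge0// ?mulr_ge0// ltW.
move=> x; rewrite (le_trans (graph_norm_le _))// lecR !mulrDl mul1r -addrA.
apply: lerD => //; have [dx ex] := RP x.
have -> : A (resolvent A s x) = s *: resolvent A s x - x.
  by rewrite -[X in _ - X]ex subKr.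
rewrite (le_trans (rnormB _ _))// lerD2r -mulrA.
have -> : rnorm (s *: resolvent A s x) = complex.Re `|s| * rnorm (resolvent A s x).
  rewrite [LHS]/rnorm normrZ rnormE -{1}[`|s|]RRe_real ?normr_real//.
  by rewrite -(rmorphM (real_complex R)).
by apply: ler_pM; rewrite ?rnorm_ge0 ?ler_norm// -ler0c RRe_real ?normr_real.
Qed.

Lemma resolvent_bounded_into (V : hilbertType R) s (K : V -> X) :
  resolvent_set A s -> bounded_operator K ->
  bounded_into (dom A) (graph_norm A) (fun v => resolvent A s (K v)).
Proof.
move=> rs /bounded_operatorP[lK [k k0 hk]].
have [m m0 hm] := resolvent_graph_bounded rs.
have [[lR _] RP _] := resolvent_ofP rs.
split; first by move=> a x y; rewrite lK lR.
  by move=> v; case: (RP (K v)).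
exists (m * k)%:C%C => v; rewrite (le_trans (hm _))// rnormE -rmorphM lecR.
by rewrite -mulrA ler_pM2l.
Qed.
End GraphNorm.

Section SchurComplement.
Context {R : realType} {X U : hilbertType R} {A : unbounded_operator X}.
Context {B : U -> X} {C : X -> U} {G : U -> U} {s : R[i]}.
Hypotheses (rs : resolvent_set A s).
Hypotheses (bB : bounded_operator B) (bC : bounded_operator C).
Hypotheses (bG : bounded_operator G).
Let Rs := resolvent A s.
Hypotheses (GH : forall w, G (C (Rs (B w))) = w) (HG : forall w, C (Rs (B (G w))) = w).
Let P u := s *: u - A u.
Let RP := resolvent_ofP rs.
Let lR : linear Rs := let: And3 (conj l _) _ _ := RP in l.
Let bR : bounded_operator Rs := let: And3 b _ _ := RP in b.
Let lB : linear B := let: conj l _ := bB in l.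
Let lC : linear C := let: conj l _ := bC in l.
Let lG : linear G := let: conj l _ := bG in l.

(** Block elimination: the first equation gives u in terms of u_-, and then
    the second one reads C (s - A)^-1 B u_- = C (s - A)^-1 v - v_+. *)
Lemma grushin_solution v vp u um : dom A u -> P u + B um = v -> C u = vp ->
  u = Rs (v - B um) /\ um = G (C (Rs v)) - G vp.
Proof.
move=> du Pu Cu; have [_ _ RK] := RP.
have uE : u = Rs (v - B um) by rewrite -Pu addrK; exact/esym/RK.
split => //; rewrite -(linear_funB _ _ lG) -Cu uE.
rewrite (linear_funB _ _ lR) (linear_funB _ _ lC) subKr GH.
by [].
Qed.

(** The inverse of the block operator, with the inverse G of its Schur complement
    (up to sign) in the corner. *)
Lemma schur_grushin_inverse :
  grushin_inverse (dom A) (graph_norm A) P B C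
    (fun v => Rs (v - B (G (C (Rs v))))) (fun w => Rs (B (G w)))
    (fun v => G (C (Rs v))) (fun w => - G w).
Proof.
have [_ R1 R2] := RP.
have bGCR : bounded_operator (fun v => G (C (Rs v))).
  by apply: (bounded_operator_comp bG); exact: bounded_operator_comp bC bR.
split.
- split; apply: resolvent_bounded_into => //.
    apply: bounded_operatorB; first exact: bounded_operator_id.
    exact: bounded_operator_comp bB bGCR.
  exact: bounded_operator_comp bB bG.
- by split => //; exact: bounded_operatorN.
- move=> [v w]; rewrite /grushin_op /block_op /=; congr pair.
    rewrite -(linear_funD _ _ lR) /P; have [_ ->] := R1 (v - B (G (C (Rs v))) + B (G w)).
    by rewrite (linear_funB _ _ lB) addrACA subrr addr0 subrK.
  rewrite (linear_funD _ _ lC) HG (linear_funB _ _ lR) (linear_funB _ _ lC) HG subrr.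
  by rewrite add0r.
- move=> [u um] /= du; rewrite /grushin_op /block_op /=.
  have [uE umE] := grushin_solution du (erefl (P u + B um)) (erefl (C u)).
  move: uE umE; set v := P u + B um => uE umE.
  have BE : B um = B (G (C (Rs v))) - B (G (C u)).
    by rewrite -(linear_funB _ _ lB) -umE.
  congr pair; last by rewrite -umE.
  by rewrite -(linear_funD _ _ lR) [RHS]uE BE opprB addrA addrAC.
Qed.
End SchurComplement.

Theorem proposition3p1 (R : realType) (X U : hilbertType R)
    (A : unbounded_operator X) (B : U -> X) (Bs : X -> U)
    (H : R[i] -> U -> U) (lambda : R[i])
    (skewA : skew_adjoint A)
    (bddB : bounded_operator B)
    (adjB : adjoint_of B Bs)
    (wpAB : well_posed_triple A B Bs)
    (tfH : transfer_function A B Bs H)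
    (rho_lambda : resolvent_set A lambda)
    (invH : exists G, bounded_inverse (H lambda) G) :
  let P := fun u : X => lambda *: u - A u in
  [/\ grushin_well_posed (dom A) (graph_norm A) P B Bs,
      (forall (v : X) (vp : U), exists! p : X * U,
         [/\ dom A p.1, P p.1 + B p.2 = v & Bs p.1 = vp]),
      (exists m : R[i], forall (v : X) (vp : U) (u : X) (um : U),
         dom A u -> P u + B um = v -> Bs u = vp ->
         graph_norm A u + `|um| <= m * (`|v| + `|vp|))
    & forall Emp : U -> U,
        effective_hamiltonian (dom A) (graph_norm A) P B Bs Emp ->
        exists K : U -> U,
          [/\ bounded_inverse Emp K,
              forall w, K w = - Bs (resolvent A lambda (B w))
            & forall w, - Bs (resolvent A lambda (B w)) = - H lambda w]].
Proof.
move=> P; have [T [_ [genT _ _ _ _]]] := wpAB.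
have HE := transfer_function_resolvent skewA genT bddB adjB tfH rho_lambda.
have [G [bH bG GH HG]] := invH.
have bBs := adjoint_bounded adjB bddB.
have GH' w : G (Bs (resolvent A lambda (B w))) = w by rewrite -HE GH.
have HG' w : Bs (resolvent A lambda (B (G w))) = w by rewrite -HE HG.
have inv := schur_grushin_inverse rho_lambda bddB bBs bG GH' HG'.
have uniq v vp u um := @grushin_solution _ _ _ _ _ _ _ _ rho_lambda bBs bG GH' v vp u um.
have [bR RP _] := resolvent_ofP rho_lambda.
split.
- by do 4!eexists; exact: inv.
- move=> v vp; have [[[_ dE _] [_ dEp _]] _ sol _] := inv.
  have := domD (dE v) (dEp vp); have := sol (v, vp); rewrite /block_op /=.
  set u0 := (X in dom A X); set um0 := G _ + _ => -[e1 e2] du0.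
  exists (u0, um0); split => // -[u um] /= [du Pu Bu].
  have [-> ->] := uniq _ _ _ _ du Pu Bu.
  by have [{1}-> {2}->] := uniq _ _ _ _ du0 e1 e2.
- have [m m0 hm] := resolvent_graph_bounded rho_lambda.
  have /bounded_operatorP[_ [b b0 hb]] := bddB.
  have /bounded_operatorP[lG [g g0 hg]] := bG.
  have /bounded_operatorP[_ [k k0 hk]] := bounded_operator_comp bBs bR.
  pose c := g * (k + 1).
  exists (m * (1 + b * c) + c)%:C%C => v vp u um du Pu Bu.
  have [-> umE] := uniq _ _ _ _ du Pu Bu.
  have nv := rnorm_ge0 v; have nvp := rnorm_ge0 vp.
  have um_le : rnorm um <= c * (rnorm v + rnorm vp).
    rewrite umE -(linear_funB _ _ lG) (le_trans (hg _))// /c -mulrA ler_pM2l//.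
    by have := hk v; have := rnormB (Bs (resolvent A lambda v)) vp => /=; nra.
  rewrite !rnormE -rmorphD -rmorphM (le_trans (lerD (hm _) (lexx _)))//.
  rewrite -rmorphD lecR mulrDl lerD// -mulrA ler_pM2l//.
  have := rnormB v (B um); have := hb um; have := ler_wpM2l (ltW b0) um_le; lra.
- move=> Emp [E [Ep [Em [[[lE dE _] [_ dEp _]] [[lEm _] bEmp] sol _]]]].
  have EmpE w : Emp w = - G w.
    have [/= e1 e2] := sol (0, w).
    have [_] := uniq _ _ _ _ (domD (dE _) (dEp _)) e1 e2.
    by rewrite (linear_fun0 lEm) (linear_fun0 bR.1) (linear_fun0 bBs.1) (linear_fun0 bG.1) add0r sub0r.
  exists (fun w => - H lambda w); split.
  + split; [exact: bEmp | exact: bounded_operatorN | |].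
      by move=> w; rewrite EmpE (linear_funN _ bH.1) HG opprK.
    by move=> w; rewrite EmpE (linear_funN _ bG.1) GH opprK.
  + by move=> w; rewrite HE.
  + by move=> w; rewrite HE.
Qed.
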